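(* Let $A$ be a twisted commutative algebra, considered as a polynomial functor, and let $I$ and $J$ be $\mathrm{GL}$-ideals of $A$. Then $\mathrm{rad}_{\mathrm{GL}}(I) \subset \mathrm{rad}_{\mathrm{GL}}(J)$ if and only if $\mathrm{rad}(I(\mathbf{Q}^{\infty|\infty})) \subset \mathrm{rad}(J(\mathbf{Q}^{\infty|\infty}))$.
   Context: Polynomial functors. Vector spaces are over $\mathbf{Q}$. Let $T_n$ be the functor $V \mapsto V^{\otimes n}$. An endofunctor of the category of $\mathbf{Q}$-vector spaces is polynomial if it is a subquotient of a (possibly infinite) direct sum of functors $T_n$. The category $\mathbf{Pol}$ of polynomial functors is semisimple abelian, closed under (pointwise) tensor products, with simple objects the Schur functors $\mathbf{S}_\lambda$. A polynomial functor can be evaluated on super vector spaces, by evaluating Schur functors there using the tensor product and symmetry of super vector spaces. Here $\mathbf{Q}^{r|s}$ is the super vector space with even part $\mathbf{Q}^r$ and odd part $\mathbf{Q}^s$, and $\mathbf{Q}^{\infty|\infty}=\bigcup_{r,s}\mathbf{Q}^{r|s}$. Twisted commutative algebras (tca's). A tca is a commutative (unital) algebra object $A$ of $\mathbf{Pol}$. Then $A(\mathbf{Q}^{\infty|\infty})$ is a supercommutative $\mathbf{Q}$-algebra. A subrepresentation of $A$ is a subobject of $A$ in $\mathbf{Pol}$. For subrepresentations $V,W$ of $A$, $VW$ is the image of $V\otimes W\to A$, and $V^n$ is the image of $V^{\otimes n}\to A$. A $\mathrm{GL}$-ideal of $A$ is a subobject $I$ that is an ideal. The $\mathrm{GL}$-radical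 $\mathrm{rad}_{\mathrm{GL}}(I)$ of a $\mathrm{GL}$-ideal $I$ is the sum of all subrepresentations $V$ of $A$ such that $V^n\subset I$ for some $n$. For an ideal $\mathfrak a$ of a supercommutative ring, $\mathrm{rad}(\mathfrak a)$ is the ordinary radical, i.e. the set of elements having some power in $\mathfrak a$. *)

(* Defs.v *)
From HB Require Import structures.
From mathcomp Require Import all_boot all_order all_algebra perm.
From mathcomp Require Import boolp classical_sets.

Set Implicit Arguments.
Unset Strict Implicit.
Unset Printing Implicit Defensive.

Import GRing.Theory.
Local Open Scope ring_scope.
Local Open Scope classical_set_scope.
Local Open Scope quotient_scope.

(* In fmap_id and fmap_comp the composite is given up to pointwise equality,  *)
(* so they also say that fmap respects pointwise equality of linear maps.     *)
Record vfunctor := VFunctor {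
  fobj :> lmodType rat -> lmodType rat;
  fmap : forall V W : lmodType rat, {linear V -> W} -> {linear fobj V -> fobj W};
  fmap_id : forall (V : lmodType rat) (f : {linear V -> V}),
    f =1 id -> fmap f =1 id;
  fmap_comp : forall (U V W : lmodType rat) (f : {linear U -> V})
      (g : {linear V -> W}) (h : {linear U -> W}),
    h =1 g \o f -> fmap h =1 fmap g \o fmap f
}.

Record nat_trans (F G : vfunctor) := NatTrans {
  nt :> forall V : lmodType rat, {linear F V -> G V};
  nt_natural : forall (V W : lmodType rat) (f : {linear V -> W}) (x : F V),
    nt W (fmap F f x) = fmap G f (nt V x)
}.

Definition multilinear (n : nat) (V W : lmodType rat)
    (phi : {ffun 'I_n -> V} -> W) : Prop :=
  forall (v : {ffun 'I_n -> V}) (i : 'I_n) (a : rat) (x y : V),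
    let upd z := [ffun j => if j == i then z else v j] in
    phi (upd (a *: x + y)) = a *: phi (upd x) + phi (upd y).

(* G is the direct sum of the functors V |-> V^{\otimes d i}, i ranging over  *)
(* idx, with tau i the canonical map from V^(d i) to the i-th summand. Tensor *)
(* powers and the direct sum are expressed by their joint universal property. *)
Record is_sum_of_tensor_powers (idx : Type) (d : idx -> nat) (G : vfunctor)
    (tau : forall (i : idx) (V : lmodType rat), {ffun 'I_(d i) -> V} -> G V) :
    Prop := {
  tau_multilinear : forall (i : idx) (V : lmodType rat), multilinear (tau i V);
  tau_natural : forall (i : idx) (V W : lmodType rat) (f : {linear V -> W})
      (v : {ffun 'I_(d i) -> V}),
    fmap G f (tau i V v) = tau i W [ffun j => f (v j)];
  tau_universal : forall (V W : lmodType rat)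
      (phi : forall i : idx, {ffun 'I_(d i) -> V} -> W),
    (forall i : idx, multilinear (phi i)) ->
    exists h : {linear G V -> W}, (forall i v, h (tau i V v) = phi i v) /\
      forall h' : {linear G V -> W},
        (forall i v, h' (tau i V v) = phi i v) -> h' =1 h
}.

Definition polynomial_functor (F : vfunctor) : Prop :=
  exists (idx : Type) (d : idx -> nat) (G : vfunctor)
    (tau : forall (i : idx) (V : lmodType rat), {ffun 'I_(d i) -> V} -> G V)
    (K : vfunctor) (inc : nat_trans K G) (proj : nat_trans K F),
  [/\ is_sum_of_tensor_powers tau,
      forall V : lmodType rat, injective (inc V) &
      forall (V : lmodType rat) (x : F V), exists y : K V, proj V y = x].

(* The multiplication A \otimes A -> A, for the pointwise tensor product, is  *)
(* given as a natural bilinear map, and the unit map from the constant        *)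
(* functor Q as a natural element. A may be the zero algebra.                 *)
Record tca := Tca {
  tca_functor :> vfunctor;
  tca_polynomial : polynomial_functor tca_functor;
  tmul : forall V : lmodType rat, tca_functor V -> tca_functor V -> tca_functor V;
  tone : forall V : lmodType rat, tca_functor V;
  tmul_linear : forall (V : lmodType rat) (a : rat) (x y z : tca_functor V),
    tmul (a *: x + y) z = a *: tmul x z + tmul y z;
  tmulC : forall (V : lmodType rat) (x y : tca_functor V), tmul x y = tmul y x;
  tmulA : forall (V : lmodType rat) (x y z : tca_functor V),
    tmul x (tmul y z) = tmul (tmul x y) z;
  tmul1 : forall (V : lmodType rat) (x : tca_functor V), tmul (tone V) x = x;
  tmul_natural : forall (V W : lmodType rat) (f : {linear V -> W})
      (x y : tca_functor V),
    fmap tca_functor f (tmul x y) =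
    tmul (fmap tca_functor f x) (fmap tca_functor f y);
  tone_natural : forall (V W : lmodType rat) (f : {linear V -> W}),
    fmap tca_functor f (tone V) = tone W
}.

(* A subobject of F in Pol is a subfunctor: subfunctors of polynomial         *)
(* functors are polynomial.                                                   *)
Record subrep (F : vfunctor) := Subrep {
  subrep_set :> forall V : lmodType rat, set (F V);
  subrep0 : forall V : lmodType rat, subrep_set (0 : F V);
  subrep_lin : forall (V : lmodType rat) (a : rat) (x y : F V),
    subrep_set x -> subrep_set y -> subrep_set (a *: x + y);
  subrep_fmap : forall (V W : lmodType rat) (f : {linear V -> W}) (x : F V),
    subrep_set x -> subrep_set (fmap F f x)
}.
Arguments subrep_set {F} _ V _.

Definition GL_ideal (A : tca) (I : subrep A) : Prop :=
  forall (V : lmodType rat) (a x : A V), I V x -> I V (tmul a x).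

(* The image of S^{\otimes n} -> A. *)
Definition subrep_pow (A : tca) (S : subrep A) (n : nat) (V : lmodType rat) :
    set (A V) :=
  [set x | exists (k : nat) (c : 'I_k -> rat) (s : 'I_k -> n.-tuple (A V)),
    (forall i j, S V (tnth (s i) j)) /\
    x = \sum_(i < k) c i *: foldr (@tmul A V) (tone A V) (s i)].
Arguments subrep_pow {A} S n V _.

Definition GL_rad (A : tca) (I : subrep A) (V : lmodType rat) : set (A V) :=
  [set x | exists (k : nat) (S : 'I_k -> subrep A) (y : 'I_k -> A V),
    [/\ forall i, exists n : nat,
          forall W : lmodType rat, subrep_pow (S i) n W `<=` I W,
        forall i, S i V (y i) & x = \sum_(i < k) y i]].
Arguments GL_rad {A} I V _.

(* Evaluation on super vector spaces. For a polynomial functor F, let F_n be  *)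
(* the weight (1, ..., 1) subspace of F(Q^n), with the action of S_n by       *)
(* permutation matrices; it is Hom(T_n, F), x corresponding to the            *)
(* transformation v_1 \otimes ... \otimes v_n |-> F(e_i |-> v_i)(x), and F is *)
(* the direct sum of the functors (F_n \otimes T_n)_{S_n}. In particular      *)
(* S_lambda = (Specht_lambda \otimes T_n)_{S_n}. The value of F on a super    *)
(* vector space E is therefore the direct sum of the coinvariants             *)
(* (F_n \otimes E^{\otimes n})_{S_n}, S_n acting on E^{\otimes n} through the *)
(* symmetry of super vector spaces. E is given by a homogeneous basis B and   *)
(* the parity p of its elements, so words in B form a basis of E^{\otimes n}. *)

Definition mxmap (F : vfunctor) (m n : nat) (M : 'M[rat]_(m, n)) :
    {linear F 'rV[rat]_m -> F 'rV[rat]_n} := fmap F (mulmxr M).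

Definition relabel (F : vfunctor) (m n : nat) (f : 'I_m -> 'I_n) :
    {linear F 'rV[rat]_m -> F 'rV[rat]_n} :=
  mxmap F (\matrix_(i, j) (f i == j)%:R).

Definition multiweight1 (F : vfunctor) (n : nat) (x : F 'rV[rat]_n) : Prop :=
  forall t : 'rV[rat]_n, mxmap F (diag_mx t) x = (\prod_(i < n) t 0 i) *: x.

(* The sign in w_0 ... w_{n-1} |-> +/- w_{s 0} ... w_{s (n-1)}. *)
Definition koszul (B : Type) (p : B -> bool) (n : nat) (s : 'S_n)
    (w : {ffun 'I_n -> B}) : rat :=
  \prod_(i < n) \prod_(j < n | (i < j)%N && (s j < s i)%N)
    (-1) ^+ (p (w (s i)) && p (w (s j))).

(* The pure tensor mcoef \otimes (the word mword in the basis B). *)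
Record tensor (F : vfunctor) (B : Type) := Tensor {
  tdeg : nat;
  tcoef : F 'rV[rat]_tdeg;
  tcoefP : multiweight1 tcoef;
  tword : {ffun 'I_tdeg -> B}
}.
Arguments tcoefP {F B} t.

HB.instance Definition _ (F : vfunctor) (B : Type) := gen_eqMixin (tensor F B).
HB.instance Definition _ (F : vfunctor) (B : Type) := gen_choiceMixin (tensor F B).

(* phi induces a linear map on the coinvariants. *)
Record balanced (F : vfunctor) (B : Type) (p : B -> bool) (W : lmodType rat)
    (phi : forall n : nat, F 'rV[rat]_n -> {ffun 'I_n -> B} -> W) : Prop := {
  balanced_lin : forall n (a : rat) (x y : F 'rV[rat]_n) w,
    multiweight1 x -> multiweight1 y ->
    phi n (a *: x + y) w = a *: phi n x w + phi n y w;
  balanced_perm : forall n (s : 'S_n) (x : F 'rV[rat]_n) w, multiweight1 x ->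
    phi n (relabel F s x) w =
    koszul p s w *: phi n x [ffun i => w (s i)]
}.

Definition tsum (F : vfunctor) (B : Type) (W : lmodType rat)
    (phi : forall n : nat, F 'rV[rat]_n -> {ffun 'I_n -> B} -> W)
    (s : seq (tensor F B)) : W :=
  \sum_(t <- s) phi (tdeg t) (tcoef t) (tword t).

(* Formal sums of pure tensors are equal in the coinvariants if and only if   *)
(* no balanced map separates them.                                            *)
Definition same_tensor (F : vfunctor) (B : Type) (p : B -> bool)
    (s t : seq (tensor F B)) : bool :=
  `[< forall (W : lmodType rat)
        (phi : forall n : nat, F 'rV[rat]_n -> {ffun 'I_n -> B} -> W),
      balanced p phi -> tsum phi s = tsum phi t >].

Lemma same_tensor_equiv (F : vfunctor) (B : Type) (p : B -> bool) :
  equiv_class_of (@same_tensor F B p).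
Proof.
split=> [s|s t|t s u].
- exact/asboolP.
- by apply/asboolP/asboolP => h W phi b; rewrite h.
- by move=> /asboolP h1 /asboolP h2; apply/asboolP => W phi b; rewrite h1 ?h2.
Qed.

Canonical same_tensor_equiv_rel (F : vfunctor) (B : Type) (p : B -> bool) :=
  EquivRelPack (@same_tensor_equiv F B p).

Definition super_eval (F : vfunctor) (B : Type) (p : B -> bool) : Type :=
  {eq_quot (@same_tensor_equiv_rel F B p)}.
HB.instance Definition _ (F : vfunctor) (B : Type) (p : B -> bool) :=
  Choice.on (super_eval F p).
HB.instance Definition _ (F : vfunctor) (B : Type) (p : B -> bool) :=
  EqQuotient.on (super_eval F p).

Definition tclass (F : vfunctor) (B : Type) (p : B -> bool)
    (s : seq (tensor F B)) : super_eval F p := \pi s.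

Section LinearStructure.
Variables (F : vfunctor) (B : Type) (p : B -> bool).
Local Notation E := (super_eval F p).
Local Notation cls := (tclass p).

Lemma tclassP (s t : seq (tensor F B)) :
  cls s = cls t <-> forall (W : lmodType rat)
    (phi : forall n : nat, F 'rV[rat]_n -> {ffun 'I_n -> B} -> W),
    balanced p phi -> tsum phi s = tsum phi t.
Proof.
split=> [h|h]; last by apply/eqmodP/asboolP.
by apply/asboolP; move/eqmodP: h.
Qed.

Lemma tclass_repr (x : E) : cls (repr x) = x.
Proof. exact: reprK. Qed.

Lemma tclass_ind (P : E -> Prop) : (forall s, P (cls s)) -> forall x, P x.
Proof. by move=> h x; rewrite -(tclass_repr x). Qed.

Lemma multiweight1_0 n : multiweight1 (0 : F 'rV[rat]_n).
Proof. by move=> t; rewrite linear0 scaler0. Qed.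

Lemma multiweight1_lin n (a : rat) (x y : F 'rV[rat]_n) :
  multiweight1 x -> multiweight1 y -> multiweight1 (a *: x + y).
Proof. by move=> hx hy t; rewrite linearP hx hy scalerDr !scalerA mulrC. Qed.

Lemma multiweight1_scale n (a : rat) (x : F 'rV[rat]_n) :
  multiweight1 x -> multiweight1 (a *: x).
Proof.
by move=> hx; rewrite -[_ *: _]addr0; exact: multiweight1_lin (@multiweight1_0 n).
Qed.

Definition tscale (a : rat) (t : tensor F B) : tensor F B :=
  Tensor (multiweight1_scale a (tcoefP t)) (tword t).

Section Balanced.
Variables (W : lmodType rat).
Variable phi : forall n : nat, F 'rV[rat]_n -> {ffun 'I_n -> B} -> W.
Hypothesis phiP : balanced p phi.

Lemma tsum_nil : tsum phi [::] = 0. Proof. exact: big_nil. Qed.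

Lemma tsum_cat s t : tsum phi (s ++ t) = tsum phi s + tsum phi t.
Proof. exact: big_cat. Qed.

Lemma balanced0 n w : phi (0 : F 'rV[rat]_n) w = 0.
Proof.
have := balanced_lin phiP 1 w (@multiweight1_0 n) (@multiweight1_0 n).
by rewrite !scale1r addr0 => /eqP; rewrite addrC -subr_eq subrr eq_sym => /eqP.
Qed.

Lemma balancedZ n a (x : F 'rV[rat]_n) w :
  multiweight1 x -> phi (a *: x) w = a *: phi x w.
Proof.
move=> hx; have := balanced_lin phiP a w hx (@multiweight1_0 n).
by rewrite balanced0 !addr0.
Qed.

Lemma tsum_scale a s : tsum phi (map (tscale a) s) = a *: tsum phi s.
Proof.
rewrite /tsum big_map scaler_sumr; apply: eq_bigr => t _ /=.
exact/balancedZ/tcoefP.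
Qed.

End Balanced.

Definition sadd (x y : E) : E := cls (repr x ++ repr y).
Definition sscale (a : rat) (x : E) : E := cls (map (tscale a) (repr x)).

Lemma tsum_repr s (W : lmodType rat)
    (phi : forall n : nat, F 'rV[rat]_n -> {ffun 'I_n -> B} -> W) :
  balanced p phi -> tsum phi (repr (cls s)) = tsum phi s.
Proof. by move=> b; apply: (proj1 (tclassP _ _)) => //; rewrite tclass_repr. Qed.

Lemma saddE s t : sadd (cls s) (cls t) = cls (s ++ t).
Proof. by apply/tclassP => W phi b; rewrite !tsum_cat !tsum_repr. Qed.

Lemma sscaleE a s : sscale a (cls s) = cls (map (tscale a) s).
Proof.
by apply/tclassP => W phi b; rewrite !(tsum_scale b) tsum_repr.
Qed.

Lemma saddA : associative sadd.
Proof.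
elim/tclass_ind=> s; elim/tclass_ind=> t; elim/tclass_ind=> u.
by rewrite !saddE catA.
Qed.

Lemma saddC : commutative sadd.
Proof.
elim/tclass_ind=> s; elim/tclass_ind=> t; rewrite !saddE.
by apply/tclassP => W phi b; rewrite !tsum_cat addrC.
Qed.

Lemma sadd0 : left_id (cls [::]) sadd.
Proof. by elim/tclass_ind=> s; rewrite saddE. Qed.

Lemma saddN : left_inverse (cls [::]) (sscale (-1)) sadd.
Proof.
elim/tclass_ind=> s; rewrite sscaleE saddE; apply/tclassP => W phi b.
by rewrite tsum_cat (tsum_scale b) tsum_nil scaleN1r addNr.
Qed.

HB.instance Definition _ := GRing.isZmodule.Build E saddA saddC sadd0 saddN.

Lemma tclassD s t : cls (s ++ t) = cls s + cls t.
Proof. exact/esym/saddE. Qed.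

Lemma sscaleA a b (x : E) : sscale a (sscale b x) = sscale (a * b) x.
Proof.
elim/tclass_ind: x => s; rewrite !sscaleE; apply/tclassP => W phi h.
by rewrite !(tsum_scale h) scalerA.
Qed.

Lemma sscale1 : left_id 1 sscale.
Proof.
elim/tclass_ind=> s; rewrite sscaleE; apply/tclassP => W phi h.
by rewrite (tsum_scale h) scale1r.
Qed.

Lemma sscaleDr : right_distributive sscale +%R.
Proof.
move=> a; elim/tclass_ind=> s; elim/tclass_ind=> t.
by rewrite -tclassD !sscaleE map_cat tclassD.
Qed.

Lemma sscaleDl (x : E) : {morph sscale^~ x : a b / a + b}.
Proof.
elim/tclass_ind: x => s a b; rewrite !sscaleE -tclassD.
by apply/tclassP => W phi h; rewrite tsum_cat !(tsum_scale h) scalerDl.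
Qed.

HB.instance Definition _ :=
  GRing.Zmodule_isLmodule.Build rat E sscaleA sscale1 sscaleDr sscaleDl.

Lemma tclass0 : cls [::] = 0. Proof. by []. Qed.

Lemma tclassZ a s : cls (map (tscale a) s) = a *: cls s.
Proof. exact/esym/sscaleE. Qed.

End LinearStructure.

Section RingStructure.
Variables (A : tca) (B : Type) (p : B -> bool).
Local Notation E := (super_eval A p).
Local Notation cls := (tclass p).

Lemma relabel_comp (F : vfunctor) m n k (f : 'I_m -> 'I_n) (g : 'I_n -> 'I_k)
    (h : 'I_m -> 'I_k) (x : F 'rV[rat]_m) :
  h =1 g \o f -> relabel F g (relabel F f x) = relabel F h x.
Proof.
move=> hE; rewrite /relabel /mxmap; apply/esym/fmap_comp => u /=.
rewrite -mulmxA; congr (_ *m _); apply/matrixP => i j; rewrite !mxE.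
rewrite (bigD1 (f i)) //= big1 ?addr0 => [|l /negPf nl].
  by rewrite !mxE eqxx mul1r hE.
by rewrite mxE eq_sym nl mul0r.
Qed.

Lemma relabel_id (F : vfunctor) n (f : 'I_n -> 'I_n) (x : F 'rV[rat]_n) :
  f =1 id -> relabel F f x = x.
Proof.
move=> fE; apply: fmap_id => u /=; rewrite -[RHS]mulmx1; congr (_ *m _).
by apply/matrixP => i j; rewrite !mxE fE.
Qed.

Lemma relabel_diag (F : vfunctor) m n (f : 'I_m -> 'I_n) (t : 'rV[rat]_n)
    (x : F 'rV[rat]_m) :
  mxmap F (diag_mx t) (relabel F f x) =
  relabel F f (mxmap F (diag_mx (\row_i t 0 (f i))) x).
Proof.
pose M := (\matrix_(i < m, j < n) (f i == j)%:R : 'M[rat]_(m, n)).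
have c (k : nat) (N1 : 'M[rat]_(m, k)) (N2 : 'M[rat]_(k, n)) y :
    mxmap F N2 (mxmap F N1 y) = mxmap F (N1 *m N2) y.
  by apply/esym/fmap_comp => u /=; rewrite mulmxA.
rewrite /relabel !c; congr (mxmap F _ x); apply/matrixP => i j.
rewrite mul_mx_diag mul_diag_mx !mxE.
by case: eqP => [->|]; rewrite ?mulr1 ?mul1r ?mulr0 ?mul0r.
Qed.

Definition wcat m n (w : {ffun 'I_m -> B}) (v : {ffun 'I_n -> B}) :
    {ffun 'I_(m + n) -> B} :=
  [ffun k => match split k with inl i => w i | inr j => v j end].

Definition ccat m n (x : A 'rV[rat]_m) (y : A 'rV[rat]_n) : A 'rV[rat]_(m + n) :=
  tmul (relabel A (@lshift m n) x) (relabel A (@rshift m n) y).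

Lemma relabelM m n (f : 'I_m -> 'I_n) (x y : A 'rV[rat]_m) :
  relabel A f (tmul x y) = tmul (relabel A f x) (relabel A f y).
Proof. exact: tmul_natural. Qed.

Lemma tmul_linear_r (V : lmodType rat) (a : rat) (x y z : A V) :
  tmul z (a *: x + y) = a *: tmul z x + tmul z y.
Proof. by rewrite ![tmul z _]tmulC tmul_linear. Qed.

Lemma tmul0l (V : lmodType rat) (x : A V) : tmul 0 x = 0.
Proof.
have := tmul_linear 1 0 0 x; rewrite !scale1r addr0 => /eqP.
by rewrite addrC -subr_eq subrr eq_sym => /eqP.
Qed.

Lemma tmulZl (V : lmodType rat) a (x y : A V) : tmul (a *: x) y = a *: tmul x y.
Proof. by have := tmul_linear a x 0 y; rewrite tmul0l !addr0. Qed.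

Lemma tmulZr (V : lmodType rat) a (x y : A V) : tmul x (a *: y) = a *: tmul x y.
Proof. by rewrite tmulC tmulZl tmulC. Qed.

Lemma multiweight1_ccat m n (x : A 'rV[rat]_m) (y : A 'rV[rat]_n) :
  multiweight1 x -> multiweight1 y -> multiweight1 (ccat x y).
Proof.
move=> hx hy t; rewrite /mxmap tmul_natural -!/(mxmap _ _) !relabel_diag hx hy.
rewrite !linearZ tmulZl tmulZr scalerA big_split_ord /=.
by congr (_ * _ *: _); apply: eq_bigr => i _; rewrite mxE.
Qed.

Lemma multiweight1_one : multiweight1 (tone A 'rV[rat]_0).
Proof. by move=> t; rewrite big_ord0 scale1r; apply: tone_natural. Qed.

Definition tensor_mul (t u : tensor A B) : tensor A B :=
  Tensor (multiweight1_ccat (tcoefP t) (tcoefP u)) (wcat (tword t) (tword u)).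

Definition empty_word : {ffun 'I_0 -> B} :=
  [ffun i : 'I_0 => match notF (ltn_ord i) with end].

Definition tensor_one : tensor A B := Tensor multiweight1_one empty_word.

Definition block_fun m n (s : 'S_m) (r : 'S_n) (k : 'I_(m + n)) : 'I_(m + n) :=
  match split k with inl i => lshift n (s i) | inr j => rshift m (r j) end.

Lemma block_fun_inj m n (s : 'S_m) (r : 'S_n) : injective (block_fun s r).
Proof.
move=> k l; rewrite /block_fun; case: (split_ordP k) => i ->;
  case: (split_ordP l) => j -> /eqP; rewrite ?eq_lshift ?eq_rshift ?eq_lrshift
    ?eq_rlshift // => /eqP /perm_inj -> //.
Qed.

Definition block_perm m n (s : 'S_m) (r : 'S_n) : 'S_(m + n) :=
  perm (@block_fun_inj m n s r).

Lemma block_perml m n (s : 'S_m) (r : 'S_n) i :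
  block_perm s r (lshift n i) = lshift n (s i).
Proof. by rewrite permE /block_fun (unsplitK (inl i)). Qed.

Lemma block_permr m n (s : 'S_m) (r : 'S_n) i :
  block_perm s r (rshift m i) = rshift m (r i).
Proof. by rewrite permE /block_fun (unsplitK (inr i)). Qed.

Lemma wcatl m n (w : {ffun 'I_m -> B}) (v : {ffun 'I_n -> B}) i :
  wcat w v (lshift n i) = w i.
Proof. by rewrite ffunE (unsplitK (inl i)). Qed.

Lemma wcatr m n (w : {ffun 'I_m -> B}) (v : {ffun 'I_n -> B}) i :
  wcat w v (rshift m i) = v i.
Proof. by rewrite ffunE (unsplitK (inr i)). Qed.

Lemma koszul_block m n (s : 'S_m) (r : 'S_n) w v :
  koszul p (block_perm s r) (wcat w v) = koszul p s w * koszul p r v.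
Proof.
rewrite /koszul big_split_ord /=; congr (_ * _); apply: eq_bigr => i _.
  rewrite big_split_ord /= [X in _ * X]big1 ?mulr1 => [|j].
    apply: eq_big => [j|j _]; first by rewrite !block_perml.
    by rewrite !block_perml !wcatl.
  rewrite block_perml block_permr /= => /andP[_].
  by rewrite ltnNge ltnW // (leq_trans (ltn_ord _)) // leq_addr.
rewrite big_split_ord /= [X in X * _]big1 ?mul1r => [|j].
  apply: eq_big => [j|j _]; first by rewrite !block_permr /= !ltn_add2l.
  by rewrite !block_permr !wcatr.
by move=> /andP[]; rewrite ltnNge ltnW // (leq_trans (ltn_ord _)) // leq_addr.
Qed.

Lemma koszul1 n (w : {ffun 'I_n -> B}) : koszul p 1%g w = 1.
Proof.
rewrite /koszul big1 // => i _; rewrite big1 // => j.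
by rewrite !perm1 => /andP[h]; rewrite ltnNge (ltnW h).
Qed.

Lemma wcat_perm m n (s : 'S_m) (r : 'S_n) w v :
  [ffun k => wcat w v (block_perm s r k)] =
  wcat [ffun i => w (s i)] [ffun j => v (r j)].
Proof.
apply/ffunP => k; rewrite [LHS]ffunE; case: (split_ordP k) => i ->.
  by rewrite block_perml !wcatl ffunE.
by rewrite block_permr !wcatr ffunE.
Qed.

Lemma ccat_perm m n (s : 'S_m) (r : 'S_n) (x : A 'rV[rat]_m) (y : A 'rV[rat]_n) :
  ccat (relabel A s x) (relabel A r y) = relabel A (block_perm s r) (ccat x y).
Proof.
rewrite relabelM /ccat; congr tmul; rewrite !(relabel_comp _ (fun _ => erefl)).
  by congr (relabel A _ _); apply/funext => i; rewrite /= block_perml.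
by congr (relabel A _ _); apply/funext => i; rewrite /= block_permr.
Qed.

Section Balanced.
Variables (W : lmodType rat).
Variable phi : forall n : nat, A 'rV[rat]_n -> {ffun 'I_n -> B} -> W.
Hypothesis phiP : balanced p phi.

Lemma balanced_mull (u : tensor A B) :
  balanced p (fun n x w => phi (ccat x (tcoef u)) (wcat w (tword u))).
Proof.
split=> [n a x y w hx hy|n s x w hx].
  rewrite {1}/ccat linearP tmul_linear (balanced_lin phiP) //;
    exact: multiweight1_ccat (tcoefP u).
rewrite -[tcoef u](relabel_id (f := (1%g : 'S_(tdeg u)))); last exact: perm1.
rewrite ccat_perm (balanced_perm phiP); last exact/multiweight1_ccat/tcoefP.
rewrite koszul_block koszul1 mulr1 wcat_perm relabel_id; last exact: perm1.
by congr (_ *: phi _ (wcat _ _)); apply/ffunP => j; rewrite ffunE perm1.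
Qed.

Lemma balanced_mulr (u : tensor A B) :
  balanced p (fun n x w => phi (ccat (tcoef u) x) (wcat (tword u) w)).
Proof.
split=> [n a x y w hx hy|n s x w hx].
  rewrite {1}/ccat linearP tmul_linear_r (balanced_lin phiP) //;
    exact: multiweight1_ccat (tcoefP u) _.
rewrite -[tcoef u](relabel_id (f := (1%g : 'S_(tdeg u)))); last exact: perm1.
rewrite ccat_perm (balanced_perm phiP); last exact/multiweight1_ccat/hx/tcoefP.
rewrite koszul_block koszul1 mul1r wcat_perm relabel_id; last exact: perm1.
by congr (_ *: phi _ (wcat _ _)); apply/ffunP => j; rewrite ffunE perm1.
Qed.

Lemma balanced_cast m n (e : m = n) (f : 'I_m -> 'I_n) (x : A 'rV[rat]_m)
    (w : {ffun 'I_m -> B}) (v : {ffun 'I_n -> B}) :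
  (forall i, f i = i :> nat) -> (forall i, w i = v (f i)) ->
  phi (relabel A f x) v = phi x w.
Proof.
case: n / e f v => f v hf hw.
have fE : f =1 id by move=> i; apply/val_inj/hf.
by rewrite relabel_id //; congr phi; apply/ffunP => i; rewrite hw fE.
Qed.

End Balanced.

Definition sum_mul (s t : seq (tensor A B)) : seq (tensor A B) :=
  [seq tensor_mul x y | x <- s, y <- t].

Definition smul (x y : E) : E := cls (sum_mul (repr x) (repr y)).

Lemma tsum_mul (W : lmodType rat)
    (phi : forall n : nat, A 'rV[rat]_n -> {ffun 'I_n -> B} -> W) s t :
  tsum phi (sum_mul s t) =
  \sum_(x <- s) \sum_(y <- t)
    phi _ (ccat (tcoef x) (tcoef y)) (wcat (tword x) (tword y)).
Proof. by rewrite /tsum /sum_mul big_allpairs_dep. Qed.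

Lemma tsum_mul_repr (W : lmodType rat)
    (phi : forall n : nat, A 'rV[rat]_n -> {ffun 'I_n -> B} -> W) s t :
  balanced p phi ->
  tsum phi (sum_mul (repr (cls s)) (repr (cls t))) = tsum phi (sum_mul s t).
Proof.
move=> b; rewrite !tsum_mul.
transitivity (\sum_(x <- repr (cls s)) \sum_(y <- t)
    phi _ (ccat (tcoef x) (tcoef y)) (wcat (tword x) (tword y))).
  by apply: eq_bigr => x _; exact: (tsum_repr t (balanced_mulr b x)).
rewrite exchange_big [RHS]exchange_big; apply: eq_bigr => y _.
exact: (tsum_repr _ (balanced_mull b y)).
Qed.

Lemma smulE s t : smul (cls s) (cls t) = cls (sum_mul s t).
Proof. by apply/tclassP => W phi b; apply: tsum_mul_repr. Qed.

Lemma smulA : associative smul.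
Proof.
elim/tclass_ind=> s; elim/tclass_ind=> t; elim/tclass_ind=> u.
rewrite !smulE; apply/tclassP => W phi b; rewrite !tsum_mul big_allpairs_dep.
apply: eq_bigr => x _; rewrite big_allpairs_dep; apply: eq_bigr => y _.
apply: eq_bigr => z _ /=.
have e := addnA (tdeg x) (tdeg y) (tdeg z).
rewrite -(balanced_cast phi e (f := cast_ord e) _
  (v := wcat (wcat (tword x) (tword y)) (tword z))) //; last first.
  move=> k; case: (split_ordP k) => [i ->|j ->].
    rewrite wcatl (_ : cast_ord _ _ = lshift _ (lshift _ i)) ?wcatl //.
    exact: val_inj.
  rewrite wcatr; case: (split_ordP j) => [i ->|i ->].
    rewrite wcatl (_ : cast_ord _ _ = lshift _ (rshift _ i)) ?wcatl ?wcatr //.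
    exact: val_inj.
  rewrite wcatr (_ : cast_ord _ _ = rshift _ i) ?wcatr //.
  by apply: val_inj; rewrite /= addnA.
rewrite /ccat !relabelM tmulA; congr (phi _ (tmul (tmul _ _) _) _).
- by rewrite !(relabel_comp _ (fun _ => erefl)); congr (relabel A _ _);
    apply/funext => i; apply: val_inj.
- by rewrite !(relabel_comp _ (fun _ => erefl)); congr (relabel A _ _);
    apply/funext => i; apply: val_inj.
- by rewrite !(relabel_comp _ (fun _ => erefl)); congr (relabel A _ _);
    apply/funext => i; apply: val_inj; rewrite /= addnA.
Qed.

Lemma smul1 : left_id (cls [:: tensor_one]) smul.
Proof.
elim/tclass_ind=> s; rewrite smulE; apply/tclassP => W phi b.
rewrite tsum_mul big_seq1; apply: eq_bigr => x _ /=.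
rewrite -[RHS](balanced_cast phi (esym (add0n _)) (f := @rshift 0 _) _
  (v := wcat empty_word (tword x))) //; last by move=> i; rewrite wcatr.
by congr phi; rewrite /ccat [relabel _ _ (tone _ _)]tone_natural tmul1.
Qed.

Lemma smulr1 : right_id (cls [:: tensor_one]) smul.
Proof.
elim/tclass_ind=> s; rewrite smulE; apply/tclassP => W phi b.
rewrite tsum_mul; apply: eq_bigr => x _ /=; rewrite big_seq1 /=.
rewrite -[RHS](balanced_cast phi (esym (addn0 _)) (f := @lshift _ 0) _
  (v := wcat (tword x) empty_word)) //; last by move=> i; rewrite wcatl.
by congr phi; rewrite /ccat [relabel _ _ (tone _ _)]tone_natural tmulC tmul1.
Qed.

Lemma smulDl : left_distributive smul +%R.
Proof.
elim/tclass_ind=> s; elim/tclass_ind=> t; elim/tclass_ind=> u.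
rewrite -tclassD !smulE -tclassD; apply/tclassP => W phi b.
by rewrite tsum_cat !tsum_mul big_cat.
Qed.

Lemma smulDr : right_distributive smul +%R.
Proof.
elim/tclass_ind=> s; elim/tclass_ind=> t; elim/tclass_ind=> u.
rewrite -tclassD !smulE -tclassD; apply/tclassP => W phi b.
rewrite tsum_cat !tsum_mul -big_split; apply: eq_bigr => x _.
by rewrite big_cat.
Qed.

HB.instance Definition _ :=
  GRing.Zmodule_isPzRing.Build E smulA smul1 smulr1 smulDl smulDr.

Lemma tclassM s t : cls (sum_mul s t) = cls s * cls t.
Proof. exact/esym/smulE. Qed.

End RingStructure.

(* In characteristic 0 the functor (- \otimes E^{\otimes n})_{S_n} is exact,  *)
(* so the image of I(E) -> A(E) is I(E).                                      *)
Definition super_eval_sub (F : vfunctor) (B : Type) (p : B -> bool)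
    (I : subrep F) : set (super_eval F p) :=
  [set x | exists s : seq (tensor F B),
    (forall t, t \in s -> I _ (tcoef t)) /\ x = tclass p s].

Definition radical (R : pzRingType) (a : set R) : set R :=
  [set x | exists n : nat, a (x ^+ n)].

(* Q^{\infty|\infty} has the even basis elements inl i and the odd ones inr i. *)
Definition Qinf_parity (b : nat + nat) : bool :=
  match b with inl _ => false | inr _ => true end.

Definition at_Qinf (A : tca) (I : subrep A) : set (super_eval A Qinf_parity) :=
  super_eval_sub I.

(* Main.v *)
(* Let x in A_d = A(Q^d)_(1,...,1) generate V. A word w in d distinct letters, *)
(* each even or odd, gives an element x(w) of V(Q^{infty|infty}). By           *)
(* polarization x(w)^N lies in J(Q^{infty|infty}) if and only if the product   *)
(* of N copies of x, in N d independent vectors, lies in J after symmetrizing  *)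
(* (for even letters) or alternating (for odd ones) the N vectors in each of   *)
(* the d positions. The crux is that if this holds for all 2^d choices of      *)
(* parities, then the unsymmetrized product lies in J for some larger N, so    *)
(* that V^N is contained in J. One removes the (anti)symmetrizations one       *)
(* position at a time: a representation of the symmetric group S_M with        *)
(* M >= a b on which all symmetrizers over a letters and all alternators over  *)
(* b letters vanish is zero, as a partition of M has a row of length a or a    *)
(* column of length b. Finally an arbitrary element of a polynomial functor is *)
(* a combination of values F(f)(x) with x of multiweight (1,...,1) in the      *)
(* subfunctor that it generates.                                               *)

Require Import Defs.
From HB Require Import structures.
From mathcomp Require Import boolp classical_sets.
From mathcomp Require Import all_boot all_order all_algebra all_fingroup.

Set Implicit Arguments.
Unset Strict Implicit.
Unset Printing Implicit Defensive.

Import Order.TTheory GRing.Theory Num.Theory.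
Local Open Scope ring_scope.

(** * Symmetrizers and alternators *)

(** Forward: an element of [at_Qinf I] has finitely many coefficients, all in I and hence in
    rad_GL(J). By [GL_radP] and [nilpotent_mod_sum] they lie in one subrepresentation S with S^N
    inside J, and by [super_power] the N-th power has coefficients that are products of N elements
    of S.

    Backward: let S^n lie in I. By [polynomial_generation] it is enough that each x in S of
    multiweight (1, ..., 1) generates a subrepresentation nilpotent modulo J. For each choice [eps]
    of parities of d distinct letters, x tensored with that word has its n-th power in I, so some
    N-th power in J. The linear map [desuper] to A(V) shows that the product of N copies of x,
    symmetrized at even positions and alternated at odd ones, lies in J ([power_vanishes]).
    [vanishes_average] passes to equivariant coefficients, and [vanishes_step] frees one position:
    if N_0 copies suffice when it is even and N_1 when it is odd, then N_0 N_1 suffice with no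
    symmetry there. When all positions are free ([vanishes_all]), [nilpotent_generated] concludes.

    The step rests on [symmetrize_or_alternate], whose source is that a partition of ab has a row of
    length at least a or a column of length at least b; the proof needs no Specht modules. *)

Definition subspace (W : lmodType rat) (J : W -> Prop) : Prop :=
  J 0 /\ forall a x y, J x -> J y -> J (a *: x + y).

Section Subspace.
Variables (W : lmodType rat) (J : W -> Prop).
Hypothesis JP : subspace J.

Lemma subspaceD x y : J x -> J y -> J (x + y).
Proof. by move=> hx hy; rewrite -[x]scale1r; apply: JP.2. Qed.

Lemma subspaceZ a x : J x -> J (a *: x).
Proof. by move=> hx; rewrite -[_ *: _]addr0; apply: JP.2 => //; exact: JP.1. Qed.

Lemma subspaceB x y : J x -> J y -> J (x - y).
Proof. by move=> hx hy; rewrite -scaleN1r; apply: subspaceD => //; exact: subspaceZ. Qed.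

Lemma subspace_sum (I : Type) (r : seq I) (P : pred I) (F : I -> W) :
  (forall i, P i -> J (F i)) -> J (\sum_(i <- r | P i) F i).
Proof. by apply: big_ind => [|x y]; [exact: JP.1 | exact: subspaceD]. Qed.

Lemma subspaceZ_inv a x : a != 0 -> J (a *: x) -> J x.
Proof. by move=> a0 /(subspaceZ a^-1); rewrite scalerA mulVf ?scale1r. Qed.

End Subspace.

Section Symmetrization.
Variables (T : finType) (W : lmodType rat).
Implicit Types (e : bool) (A B R : {set T}) (s t g : {perm T}) (z : {perm T} -> W).

Definition psign e s : rat := (-1) ^+ (e && s).

Lemma psign1 e : psign e 1 = 1.
Proof. by rewrite /psign odd_perm1 andbF. Qed.

Lemma psignM e s t : psign e (s * t) = psign e s * psign e t.
Proof. by rewrite /psign odd_permM; case: e => //=; rewrite ?mulr1 // signr_addb. Qed.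

Lemma psignV e s : psign e s^-1 = psign e s.
Proof. by rewrite /psign odd_permV. Qed.

Definition symz e A z : {perm T} -> W :=
  fun g => \sum_(s | perm_on A s) psign e s *: z (s * g)%g.

Lemma perm_onS A B s : A \subset B -> perm_on A s -> perm_on B s.
Proof. by move=> AB h; apply/subsetP => x /(subsetP h); exact: (subsetP AB). Qed.

Lemma symz_perm e A z t g : perm_on A t ->
  symz e A z (t * g)%g = psign e t *: symz e A z g.
Proof.
move=> ht; rewrite /symz scaler_sumr (reindex_inj (mulIg t^-1%g)) /=.
apply: eq_big => [s|s _].
  apply/idP/idP => hs; last exact/perm_onM/perm_onV.
  by rewrite -[s](mulgKV t); exact: perm_onM.
by rewrite !mulgA mulgKV psignM psignV mulrC scalerA.
Qed.

(** Coset decomposition of the group of [j |: A] by the image [m] of [j]; the transpositions [(j m)]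
    are representatives. *)
Lemma symz_insert e A z j g : j \notin A ->
  symz e (j |: A) z g =
  \sum_(m in j |: A) psign e (tperm j m) *: symz e A z (tperm j m * g)%g.
Proof.
move=> jA; rewrite /symz
  (partition_big (fun s : {perm T} => s j) (mem (j |: A))) /=; last first.
  by move=> s /perm_closed ->; rewrite setU11.
apply: eq_bigr => m mA; rewrite scaler_sumr (reindex_inj (mulIg (tperm j m))) /=.
have tA : perm_on (j |: A) (tperm j m).
  by apply: perm_onS (tperm_on j m); rewrite subUset !sub1set setU11.
apply: eq_big => [s|s _]; last by rewrite mulgA psignM mulrC scalerA.
rewrite permM; apply/andP/idP => [[hs /eqP sj]|hs].
  have {}sj : s j = j by apply: (@perm_inj _ (tperm j m)); rewrite sj tpermL.
  have {}hs : perm_on (j |: A) s.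
    by rewrite -[s](mulgK (tperm j m)); apply: perm_onM => //; rewrite tpermV.
  apply/subsetP => i si; have := subsetP hs i si; rewrite !inE => /orP[/eqP ij|//].
  by move: si; rewrite inE ij sj eqxx.
split; first by apply: perm_onM => //; apply: perm_onS hs; exact: subsetUr.
by rewrite (out_perm hs) // tpermL.
Qed.

Lemma symz_inv A z g : (forall s h, perm_on A s -> z (s * h)%g = z h) ->
  symz false A z g = #|perm_on A|%:R *: z g.
Proof.
move=> hz; rewrite /symz (eq_bigr (fun => z g)) => [|s hs]; last first.
  by rewrite hz // scale1r.
by rewrite sumr_const scaler_nat.
Qed.

Lemma symz0 e z : symz e set0 z =1 z.
Proof.
move=> g; rewrite /symz (big_pred1 1%g) ?psign1 ?scale1r ?mul1g // => s.
by apply/idP/eqP => [/perm_on_id->|->]; rewrite ?cards0 ?perm_on1.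
Qed.

Lemma symz1 e j z : symz e [set j] z =1 z.
Proof.
move=> g; rewrite /symz (big_pred1 1%g) ?psign1 ?scale1r ?mul1g // => s.
by apply/idP/eqP => [/perm_on_id->|->]; rewrite ?cards1 ?perm_on1.
Qed.

Lemma card_perm_on_neq0 A : #|perm_on A|%:R != 0 :> rat.
Proof. by rewrite card_perm pnatr_eq0 -lt0n fact_gt0. Qed.

Variable J : W -> Prop.
Hypothesis JP : subspace J.

Definition closed_under R (N : ({perm T} -> W) -> Prop) : Prop :=
  [/\ N (fun => 0), forall a z1 z2, N z1 -> N z2 -> N (fun g => a *: z1 g + z2 g)
    & forall s z, perm_on R s -> N z -> N (fun g => z (s * g)%g)].

Lemma closed_sum R N (I : Type) (r : seq I) (P : pred I) (c : I -> rat)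
    (F : I -> {perm T} -> W) :
  closed_under R N -> (forall i, P i -> N (F i)) ->
  N (fun g => \sum_(i <- r | P i) c i *: F i g).
Proof.
move=> [N0 Nl _] hF; elim: r => [|i r IHr].
  by rewrite (_ : (fun=> _) = fun=> 0) //; apply: funext => g; rewrite big_nil.
case hi: (P i); last first.
  by congr N : IHr; apply: funext => g; rewrite big_cons hi.
rewrite (_ : (fun g => _) = fun g => c i *: F i g + \sum_(i <- r | P i) c i *: F i g).
  by apply: Nl => //; exact: hF.
by apply: funext => g; rewrite big_cons hi.
Qed.

Lemma closed_symz R N e A z : closed_under R N -> A \subset R -> N z -> N (symz e A z).
Proof.
move=> hN AR hz; rewrite /symz; apply: (closed_sum _ _ hN) => s hs.
by case: hN => _ _; apply => //; exact: perm_onS hs.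
Qed.

(* A highest weight argument. In the application [A] is a largest set whose    *)
(* symmetrizer is nonzero modulo [J]; then for [j] outside [A] the sum of the  *)
(* transpositions [(j m)], [m] in [A], acts on [z] as [-1] modulo [J], so all  *)
(* terms of the symmetrized alternation are nonnegative multiples of [z g].    *)
Lemma alternation_insert A B l z g :
  l \in A -> [disjoint A & B] ->
  (forall s h, perm_on A s -> z (s * h)%g = z h) ->
  (forall j h, j \in B -> J (symz false (j |: A) z h)) ->
  J (\sum_(s | perm_on A s) (z (s * g)%g - \sum_(j in B) z (tperm l j * (s * g))%g)) ->
  J (z g).
Proof.
move=> lA dAB zA zB h.
pose n : rat := #|perm_on A|%:R.
have a0 : #|A|%:R != 0 :> rat.
  by rewrite pnatr_eq0 -lt0n; apply/card_gt0P; exists l.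
have n0 : n != 0 by exact: card_perm_on_neq0.
have zBE j h' : j \in B -> J (z h' + \sum_(m in A) z (tperm j m * h')%g).
  move=> jB; have jA : j \notin A by apply: contraTN jB => jA; rewrite (disjointFr dAB).
  have := zB j h' jB; rewrite symz_insert // big_setU1 //= tperm1 psign1 mul1g scale1r.
  rewrite symz_inv // => H; apply: (subspaceZ_inv JP n0); move: H.
  rewrite scalerDr scaler_sumr; congr (J (_ + _)); apply: eq_bigr => m _.
  by rewrite symz_inv // scale1r.
(* Conjugation by [(l m)] turns [(l j)] into [(j m)]. As [z] is invariant under [perm_on A] and the
   sum runs over all of it, each [m] in [A] gives the same sum; [zBE] evaluates the total over
   [m]. *)
have key j : j \in B ->
    J (#|A|%:R *: (\sum_(s | perm_on A s) z (tperm l j * (s * g))%g) + n *: z g).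
  move=> jB; have -> : #|A|%:R *: (\sum_(s | perm_on A s) z (tperm l j * (s * g))%g) =
      \sum_(s | perm_on A s) \sum_(m in A) z (tperm j m * (s * g))%g.
    rewrite exchange_big /= scaler_nat -sumr_const; apply: eq_bigr => m mA.
    have tA : perm_on A (tperm l m).
      by apply: perm_onS (tperm_on l m); rewrite subUset !sub1set lA.
    have jA : j \notin A by apply: contraTN jB => jA; rewrite (disjointFr dAB).
    have -> : tperm l j = (tperm l m * tperm j m * tperm l m)%g.
      have : (tperm m j ^ tperm m l)%g = tperm l j.
        by rewrite tpermJ tpermL tpermD //; apply: contraNneq jA => <-.
      by rewrite conjgE tpermV mulgA [tperm m l]tpermC [tperm m j]tpermC.
    rewrite [RHS](reindex_inj (mulgI (tperm l m))) /=.
    apply: eq_big => [s|s _]; last by rewrite -!mulgA [LHS]zA.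
    apply/idP/idP => hs; first exact: perm_onM.
    by rewrite -[s](mulKg (tperm l m)); apply: perm_onM => //; rewrite tpermV.
  rewrite /n scaler_nat -sumr_const -big_split /=; apply: (subspace_sum JP) => s hs.
  by rewrite addrC -{1}(zA s g hs); exact: zBE.
have pos : n * (#|A|%:R + #|B|%:R) != 0
  by rewrite mulf_neq0 // -natrD pnatr_eq0 addn_eq0 negb_and -!(pnatr_eq0 rat) a0.
apply: (subspaceZ_inv JP pos).
move/(subspaceZ JP #|A|%:R): h; rewrite sumrB scalerBr => h.
have /(subspaceD JP h) : J (\sum_(j in B)
    (#|A|%:R *: (\sum_(s | perm_on A s) z (tperm l j * (s * g))%g) + n *: z g)).
  by apply: (subspace_sum JP) => j; exact: key.
rewrite big_split /= sumr_const -scaler_sumr exchange_big /= addrA subrK.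
congr J; rewrite mulrDr scalerDl; congr (_ + _).
  rewrite (eq_bigr (fun => z g)) => [|s hs]; last by rewrite zA.
  by rewrite sumr_const -scaler_nat -/n scalerA mulrC.
by rewrite -scaler_nat scalerA mulrC.
Qed.

(** Induction on [b]. If the claim fails, some nonempty [A] with fewer than [a] letters has a
    symmetrizer that is nonzero modulo [J]; take a largest one. At least [a * b] letters remain in
    [R :\: A]. For the functions invariant under [perm_on A], alternators over [b] of these letters
    vanish modulo [J], by [alternation_insert] and the vanishing over [b.+1] letters. The induction
    hypothesis then kills the symmetrizer over [A]. *)
Lemma symmetrize_or_alternate_in a b R N :
  closed_under R N -> (a * b <= #|R|)%N ->
  (forall B z g, B \subset R -> #|B| = a -> N z -> J (symz false B z g)) ->
  (forall B z g, B \subset R -> #|B| = b -> N z -> J (symz true B z g)) ->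
  forall z g, N z -> J (z g).
Proof.
elim: b R N => [|b IHb] R N hN hR hS hA z0 g0 hz0.
  by rewrite -(symz0 true); apply: hA; rewrite ?sub0set ?cards0.
case: (posnP a) => [a0|a_gt0].
  by rewrite -(symz0 false); apply: hS; rewrite ?sub0set ?cards0.
apply: contrapT => nJ.
have [j jR] : exists j, j \in R.
  by apply/card_gt0P/(leq_trans _ hR); rewrite muln_gt0 a_gt0.
pose P A := [&& A \subset R, (0 < #|A| < a)%N
  & `[< exists z g, N z /\ ~ J (symz false A z g) >]].
have Pj : P [set j].
  rewrite /P sub1set jR cards1 /= ltn_neqAle a_gt0 andbT; apply/andP; split.
    apply/eqP => a1; apply: nJ; rewrite -(symz1 false j); apply: hS => //.
      by rewrite sub1set.
    by rewrite cards1.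
  by apply/asboolP; exists z0, g0; rewrite symz1.
case: (arg_maxnP (fun A => #|A|) Pj) =>
  A /and3P[AR /andP[A_gt0 Aa] /asboolP[z [g [hz nz]]]] Amax.
apply: nz; case/card_gt0P: A_gt0 => l lA {j jR Pj}.
pose N1 z := N z /\ forall s h, perm_on A s -> z (s * h)%g = z h.
have N1z : N1 (symz false A z).
  split=> [|s h hs]; first exact: (closed_symz _ hN).
  by rewrite symz_perm // scale1r.
apply: (IHb (R :\: A) N1) N1z => {z g hz z0 g0 hz0 nJ} //.
- case: hN => N0 Nl Np; split=> [|c z1 z2 [hz1 i1] [hz2 i2]|s z hs [hz i]].
  + by [].
  + by split=> [|s h hs]; [exact: Nl | rewrite i1 ?i2].
  split=> [|t h ht].
    by apply: Np => //; apply: perm_onS hs; exact: subsetDl.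
  have tsC : commute t s.
    by apply: (perm_onC ht hs); rewrite disjoint_sym disjoints_subset subsetDr.
  by rewrite mulgA -tsC -mulgA [LHS]i.
- rewrite cardsD (setIidPr AR) leq_subRL ?subset_leq_card //.
  by apply: leq_trans hR; rewrite mulnS leq_add2r ltnW.
- move=> B z g BR Ba [hz _]; apply: hS => //.
  by apply: subset_trans BR _; exact: subsetDl.
move=> B z g BRA Bb [hz zA].
have BR : B \subset R by apply: subset_trans BRA _; exact: subsetDl.
have dAB : [disjoint A & B].
  by rewrite disjoint_sym disjoints_subset; apply: subset_trans BRA (subsetDr _ _).
have lB : l \notin B by rewrite (disjointFr dAB).
have z3A s h : perm_on A s -> symz true B z (s * h)%g = symz true B z h.
  move=> hs; apply: eq_bigr => t ht; congr (_ *: _).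
  rewrite mulgA -(perm_onC hs ht) // -mulgA zA //.
apply: (alternation_insert lA dAB z3A) => [j h jB|].
  have jA : j \notin A by rewrite (disjointFl dAB).
  have jAR : j |: A \subset R by rewrite subUset sub1set (subsetP BR).
  have Nz3 : N (symz true B z) by exact: (closed_symz _ hN).
  have [jAa|jAa] := eqVneq #|j |: A| a; first exact: hS.
  apply: contrapT => nJ; suff /Amax : P (j |: A) by rewrite /= cardsU1 jA ltnn.
  rewrite /P jAR cardsU1 jA /= ltn_neqAle Aa andbT.
  apply/andP; split; first by move: jAa; rewrite cardsU1 jA.
  by apply/asboolP; exists (symz true B z), h.
have BlE h : symz true (l |: B) z h =
    symz true B z h - \sum_(j in B) symz true B z (tperm l j * h)%g.
  rewrite symz_insert // big_setU1 //= tperm1 psign1 mul1g scale1r -sumrN.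
  congr (_ + _); apply: eq_bigr => j jB; rewrite /psign odd_tperm.
  by rewrite (_ : l != j) ?scaleN1r //; apply: contraNneq lB => ->.
apply: (subspace_sum JP) => s hs; rewrite -BlE; apply: hA => //.
  by rewrite subUset sub1set (subsetP AR).
by rewrite cardsU1 lB Bb.
Qed.

Lemma symmetrize_or_alternate a b R z :
  (a * b <= #|R|)%N ->
  (forall B g, B \subset R -> #|B| = a -> J (symz false B z g)) ->
  (forall B g, B \subset R -> #|B| = b -> J (symz true B z g)) ->
  J (z 1%g).
Proof.
move=> hR hS hA.
(* The largest admissible [N]. It is stable since translation by [s] in [perm_on R] replaces [B] by
   its image under the inverse of [s], again a subset of [R] of the same size. *)
pose N z := forall B g, B \subset R ->
  (#|B| = a -> J (symz false B z g)) /\ (#|B| = b -> J (symz true B z g)).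
apply: (@symmetrize_or_alternate_in a b R N) => //.
- have symzN e B s z' g : symz e B (fun h => z' (s * h)%g) g =
      symz e (s^-1%g @: B) z' (s * g)%g.
    rewrite /symz [RHS](reindex_inj (conjg_inj s^-1%g)) /=.
    apply: eq_big => [t|t _]; last first.
      by rewrite /psign odd_permJ conjgE invgK -!mulgA mulKg.
    have tE x : (t ^ s^-1)%g x = s^-1%g (t (s x)) by rewrite conjgE invgK !permM.
    have BE x : (x \in s^-1%g @: B) = (s x \in B).
      by rewrite -{1}[x](permK s) mem_imset //; exact: perm_inj.
    apply/subsetP/subsetP => h x; rewrite inE /= => hx.
      by rewrite BE; apply: h; rewrite inE /=;
        move: hx; rewrite tE; apply: contra_neq => ->; rewrite permK.
    have := h (s^-1%g x); rewrite inE /= tE BE permKV; apply.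
    by rewrite (inj_eq perm_inj).
  split=> [B g _|c z1 z2 h1 h2 B g BR|s z' hs hz' B g BR].
  + have h0 e : J (symz e B (fun=> 0) g).
      by apply: (subspace_sum JP) => s _; rewrite scaler0; exact: JP.1.
    by split.
  + have lE e : symz e B (fun g => c *: z1 g + z2 g) g = c *: symz e B z1 g + symz e B z2 g.
      rewrite /symz scaler_sumr -big_split; apply: eq_bigr => s _ /=.
      by rewrite scalerDr !scalerA mulrC.
    by rewrite !lE; split=> hB; apply: JP.2; [apply: (h1 B g BR).1|apply: (h2 B g BR).1|
       apply: (h1 B g BR).2|apply: (h2 B g BR).2].
  have : s^-1%g @: B \subset R.
    by rewrite -(im_perm_on (perm_onV hs)); exact: imsetS.
  move/(hz' _ (s * g)%g); rewrite !symzN card_imset //; exact: perm_inj.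
- by move=> B z' g BR Ba h; exact: (h B g BR).1.
- by move=> B z' g BR Bb h; exact: (h B g BR).2.
by move=> B g BR; split; [exact: hS | exact: hA].
Qed.
End Symmetrization.

(** * Removing symmetrizations from products *)

Definition lincomb (V : lmodType rat) n (v : 'I_n -> V) (u : 'rV[rat]_n) : V :=
  \sum_(i < n) u 0 i *: v i.

Lemma lincomb_is_linear (V : lmodType rat) n (v : 'I_n -> V) : linear (lincomb v).
Proof.
move=> a u w; rewrite /lincomb scaler_sumr -big_split; apply: eq_bigr => i _ /=.
by rewrite !mxE scalerDl scalerA.
Qed.

HB.instance Definition _ (V : lmodType rat) n (v : 'I_n -> V) :=
  GRing.isLinear.Build rat 'rV[rat]_n V _ (lincomb v) (lincomb_is_linear v).

Lemma lincomb_delta (V : lmodType rat) n (v : 'I_n -> V) i :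
  lincomb v (delta_mx 0 i) = v i.
Proof.
rewrite /lincomb (bigD1 i) //= big1 ?addr0 => [|j /negPf ji].
  by rewrite mxE !eqxx scale1r.
by rewrite mxE ji andbF scale0r.
Qed.

Section Plug.
Variable F : vfunctor.

Lemma fmap_ext (V W : lmodType rat) (f g : {linear V -> W}) (x : F V) :
  f =1 g -> fmap F f x = fmap F g x.
Proof.
move=> fg; have /= -> := @fmap_comp F V V W idfun g f (fun u => fg u) x.
by congr (fmap F g _); exact: fmap_id.
Qed.

(* [x] seen as the transformation v_1 \otimes ... \otimes v_n |-> F(e_i |-> v_i)(x). *)
Definition plug n (x : F 'rV[rat]_n) (V : lmodType rat) (v : 'I_n -> V) : F V :=
  fmap F (lincomb v) x.

Lemma eq_plug n (x : F 'rV[rat]_n) (V : lmodType rat) (v w : 'I_n -> V) :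
  v =1 w -> plug x v = plug x w.
Proof. by move=> vw; apply: fmap_ext => u; apply: eq_bigr => i _; rewrite vw. Qed.

Lemma fmap_plug n (x : F 'rV[rat]_n) (V W : lmodType rat) (f : {linear V -> W}) v :
  fmap F f (plug x v) = plug x (fun i => f (v i)).
Proof.
apply/esym/fmap_comp => u /=; rewrite /lincomb linear_sum.
by apply: eq_bigr => i _; rewrite linearZ.
Qed.

Lemma lincomb_mx m n (M : 'M[rat]_(m, n)) (V : lmodType rat) (v : 'I_n -> V) u :
  lincomb v (u *m M) = lincomb (fun i => \sum_j M i j *: v j) u.
Proof.
rewrite /lincomb (eq_bigr (fun j => \sum_i (u 0 i * M i j) *: v j)) => [|j _]; last first.
  by rewrite mxE scaler_suml.
rewrite exchange_big; apply: eq_bigr => i _; rewrite scaler_sumr.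
by apply: eq_bigr => j _; rewrite scalerA.
Qed.

Lemma plug_mxmap m n (M : 'M[rat]_(m, n)) (x : F 'rV[rat]_m) (V : lmodType rat)
    (v : 'I_n -> V) :
  plug (mxmap F M x) v = plug x (fun i => \sum_j M i j *: v j).
Proof. by apply/esym/fmap_comp => u /=; rewrite lincomb_mx. Qed.

Lemma plug_relabel m n (f : 'I_m -> 'I_n) (x : F 'rV[rat]_m) (V : lmodType rat)
    (v : 'I_n -> V) :
  plug (relabel F f x) v = plug x (fun i => v (f i)).
Proof.
rewrite plug_mxmap; apply: eq_plug => i; rewrite (bigD1 (f i)) //= big1 ?addr0.
  by rewrite mxE eqxx scale1r.
by move=> j; rewrite mxE eq_sym => /negPf ->; rewrite scale0r.
Qed.

Lemma subrep_plug (S : subrep F) n (x : F 'rV[rat]_n) (V : lmodType rat) (v : 'I_n -> V) :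
  S _ x -> S V (plug x v).
Proof. exact: subrep_fmap. Qed.

Lemma subspace_subrep (S : subrep F) (V : lmodType rat) : subspace (S V).
Proof. by split; [exact: subrep0 | move=> a x y; exact: subrep_lin]. Qed.

End Plug.

Section Products.
Variable A : tca.
Variable V : lmodType rat.

HB.instance Definition _ :=
  Monoid.isComLaw.Build (A V) (tone A V) (@tmul A V) (@tmulA A V) (@tmulC A V) (@tmul1 A V).

Lemma tmulDl (x y z : A V) : tmul (x + y) z = tmul x z + tmul y z.
Proof. by have := tmul_linear 1 x y z; rewrite !scale1r. Qed.

Lemma tmulDr (x y z : A V) : tmul z (x + y) = tmul z x + tmul z y.
Proof. by rewrite ![tmul z _]tmulC tmulDl. Qed.

Lemma tmul_suml (I : Type) (r : seq I) (P : pred I) (F : I -> A V) (x : A V) :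
  tmul (\sum_(i <- r | P i) F i) x = \sum_(i <- r | P i) tmul (F i) x.
Proof.
apply: (big_morph (fun y => tmul y x)); last exact: tmul0l.
by move=> y z; exact: tmulDl.
Qed.

End Products.

Local Notation "\tprod_ ( i 'in' S ) F" := (\big[@tmul _ _/tone _ _]_(i in S) F)
  (at level 41, F at level 41, i, S at level 50).
Local Notation "\tprod_ ( i < n ) F" := (\big[@tmul _ _/tone _ _]_(i < n) F)
  (at level 41, F at level 41, i, n at level 50).

Section Claims.
Variables (A : tca) (J : subrep A).
Variables (d : nat) (x : A 'rV[rat]_d).

Definition upd (T : finType) (s : {ffun 'I_d -> {perm T}}) q (u : {perm T}) :
  {ffun 'I_d -> {perm T}} := [ffun p => if p == q then u else s p].

Lemma upd_id (T : finType) (s : {ffun 'I_d -> {perm T}}) q : upd s q (s q) = s.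
Proof. by apply/ffunP => p; rewrite ffunE; case: eqP => [->|]. Qed.

Lemma upd_upd (T : finType) (s : {ffun 'I_d -> {perm T}}) q u w :
  upd (upd s q u) q w = upd s q w.
Proof. by apply/ffunP => p; rewrite !ffunE; case: eqP. Qed.

Lemma upd_C (T : finType) (s : {ffun 'I_d -> {perm T}}) p q u w : p != q ->
  upd (upd s p u) q w = upd (upd s q w) p u.
Proof.
move=> pq; apply/ffunP => r; rewrite !ffunE; case: eqP => // ->.
by rewrite eq_sym (negPf pq).
Qed.

Lemma updE (T : finType) (s : {ffun 'I_d -> {perm T}}) q u : upd s q u q = u.
Proof. by rewrite ffunE eqxx. Qed.

Lemma updNE (T : finType) (s : {ffun 'I_d -> {perm T}}) p q u :
  p != q -> upd s q u p = s p.
Proof. by rewrite ffunE => /negPf ->. Qed.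

Definition equivariant (k : nat) (eps : 'I_d -> bool) (T : finType) (S : {set T})
    (V : lmodType rat) (c : {ffun 'I_d -> {perm T}} -> A V) : Prop :=
  forall q : 'I_d, (q < k)%N -> forall t s, perm_on S t ->
    c (upd s q (t * s q)%g) = psign (eps q) t *: c s.

(* For [c] supported on a product of groups [perm_on S] this says that a       *)
(* partially (anti)symmetrized product of copies of [x] lies in [J]. Arbitrary *)
(* equivariant [c] make the condition pass to larger sets [S] for free, since  *)
(* an equivariant function remains equivariant for subsets of [S].             *)
Definition vanishes (k : nat) (eps : 'I_d -> bool) (N : nat) : Prop :=
  forall (T : finType) (S : {set T}) (V : lmodType rat) (v : T -> 'I_d -> V)
    (c : {ffun 'I_d -> {perm T}} -> A V),
  #|S| = N -> equivariant k eps S c ->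
  J V (\sum_s tmul (c s) (\tprod_(i in S) plug x (fun q => v (s q i) q))).

(** Permuting the vectors at position [k] by [t] makes the sum a function [z] of [t]. Its
    symmetrizers and alternators over small [B] lie in [J] by hypothesis, so
    [symmetrize_or_alternate] puts [z 1] in [J]. *)
Lemma vanishes_step (k : 'I_d) (eps : 'I_d -> bool) (N : bool -> nat) :
  (forall e, vanishes k.+1 (fun q => if q == k then e else eps q) (N e)) ->
  vanishes k eps (N false * N true).
Proof.
move=> H T S V v c hS heq.
pose m (s : {ffun 'I_d -> {perm T}}) (S : {set T}) :=
  \tprod_(i in S) plug x (fun q => v (s q i) q).
pose z (t : {perm T}) := \sum_s tmul (c (upd s k (t^-1 * s k)%g)) (m s S).
suff : J V (z 1%g).
  by congr (J V _); apply: eq_bigr => s _; rewrite invg1 mul1g upd_id.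
have key e (B : {set T}) g : B \subset S -> #|B| = N e -> J V (symz e B z g).
  move=> BS hB.
  (* The factors indexed outside [B] go into the coefficient: permutations supported on [B] do not
     move them, so equivariance over [B] survives. *)
  pose c' s := tmul (\sum_(t | perm_on B t) psign e t *:
      c (upd s k ((t * g)^-1 * s k)%g)) (m s (S :\: B)).
  have -> : symz e B z g = \sum_s tmul (c' s) (m s B).
    rewrite /symz /z.
    under eq_bigr => t _ do rewrite scaler_sumr.
    rewrite exchange_big; apply: eq_bigr => s _ /=.
    rewrite /c' -tmulA tmul_suml; apply: eq_bigr => t _.
    rewrite tmulZl; congr (_ *: tmul _ _).
    by rewrite /m (big_setID B) /= (setIidPr BS) tmulC.
  apply: (H e T B V v c' hB) => q qk t s ht.
  have mE : m (upd s q (t * s q)%g) (S :\: B) = m s (S :\: B).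
    apply: eq_bigr => i; rewrite inE => /andP[iB _]; apply: eq_plug => p.
    rewrite ffunE; case: eqP => // ->.
    by rewrite permM (out_perm ht).
  rewrite /c' mE -tmulZl; congr (tmul _ _).
  case: eqP => [->|/eqP qk'].
    rewrite scaler_sumr updE (reindex_inj (mulgI t)) /=.
    apply: eq_big => [u|u _].
      apply/idP/idP => hu; last exact: perm_onM.
      by rewrite -[u](mulKg t); apply: perm_onM => //; exact: perm_onV.
    by rewrite psignM scalerA upd_upd !invMg !mulgA mulgKV.
  rewrite scaler_sumr; apply: eq_bigr => u _.
  have {}qk : (q < k)%N by rewrite ltn_neqAle -ltnS qk andbT.
  rewrite upd_C // updNE 1?eq_sym //.
  have {1}-> : s q = upd s k ((u * g)^-1 * s k)%g q by rewrite updNE.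
  rewrite heq //; last exact: perm_onS ht.
  by rewrite !scalerA mulrC.
apply: (@symmetrize_or_alternate T (A V) (J V) (subspace_subrep J V)
  (N false) (N true) S z); first by rewrite hS.
- by move=> B g; exact: key.
- by move=> B g; exact: key.
Qed.

Lemma vanishes_all :
  (forall eps, exists N, vanishes d eps N) -> exists N,
  forall (V : lmodType rat) (v : 'I_N -> 'I_d -> V), J V (\tprod_(i < N) plug x (v i)).
Proof.
move=> H.
have {H} H k : (k <= d)%N -> forall eps, exists N, vanishes (d - k) eps N.
  elim: k => [|k IHk] hk eps; first by rewrite subn0.
  have hk' : (d - k.+1 < d)%N by rewrite subnSK // leq_subr.
  pose K := Ordinal hk'.
  have {}IHk e := IHk (ltnW hk) (fun q => if q == K then e else eps q).
  have [N hN] := choice IHk.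
  exists (N false * N true)%N; apply: (@vanishes_step K eps N) => e.
  by rewrite subnSK.
have [N hN] := H d (leqnn d) (fun=> false); exists N => V v.
(* With no equivariance left to satisfy, the indicator of the identity is allowed as coefficient and
   isolates one product. *)
have := hN 'I_N [set: 'I_N] V v (fun s => if s == [ffun=> 1%g] then tone A V else 0).
rewrite subnn cardsT card_ord => /(_ erefl).
rewrite (bigD1 [ffun=> 1%g]) //= eqxx tmul1
  [X in _ + X]big1 => [|s /negPf ->]; last exact: tmul0l.
rewrite addr0 => h; have {h} : _ := h (fun q (hq : (q < 0)%N) => match notF hq with end).
congr (J V _); apply: eq_big => [i|i _]; first by rewrite inE.
by apply: eq_plug => q; rewrite ffunE perm1.
Qed.

End Claims.

(** * Powers of words in a super vector space *)

(** Both sides run over the unordered pairs; those inverted by [s] occur in the opposite order, at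
    the cost of one factor [sg] each. *)
Lemma prod_pairs_perm (n : nat) (s : 'S_n) (sg G : 'I_n -> 'I_n -> rat) :
  (forall i j, i != j -> G i j = sg i j * G j i) ->
  \prod_(i < n) \prod_(j < n | (i < j)%N) G (s i) (s j) =
  (\prod_(i < n) \prod_(j < n | (i < j)%N && (s j < s i)%N) sg (s i) (s j)) *
  \prod_(i < n) \prod_(j < n | (i < j)%N) G i j.
Proof.
move=> Gsg.
pose G' i j := if (s j < s i)%N then G (s j) (s i) else G (s i) (s j).
have -> : \prod_(i < n) \prod_(j < n | (i < j)%N) G i j =
    \prod_(i < n) \prod_(j < n | (i < j)%N) G' i j.
  rewrite !pair_big_dep /= (reindex (fun p : 'I_n * 'I_n => (s p.1, s p.2))) /=; last first.
    exists (fun p => (s^-1%g p.1, s^-1%g p.2)) => -[i j] _ /=; by rewrite ?permK ?permKV.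
  rewrite (bigID (fun p : 'I_n * 'I_n => (p.1 < p.2)%N)) /=.
  rewrite [RHS](bigID (fun p : 'I_n * 'I_n => (s p.1 < s p.2)%N)) /=.
  congr (_ * _).
    apply: eq_big => [p|p /andP[h _]]; first by rewrite andbC.
    by rewrite /G' ltnNge (ltnW h).
  rewrite (reindex (fun p : 'I_n * 'I_n => (p.2, p.1))) /=; last first.
    by exists (fun p : 'I_n * 'I_n => (p.2, p.1)) => -[i j].
  have neq (i j : 'I_n) : i != j -> (s i < s j)%N = ~~ (s j < s i)%N.
    by move=> ij; rewrite -leqNgt ltn_neqAle (inj_eq val_inj) (inj_eq perm_inj) ij.
  apply: eq_big => [p|p /andP[h _]]; last by rewrite /G' h.
  have [->|pne] := eqVneq p.1 p.2; first by rewrite !ltnn.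
  have pne' : p.2 != p.1 by rewrite eq_sym.
  rewrite (neq p.2 p.1) // andbC -leqNgt; congr (_ && _).
  by rewrite ltn_neqAle (inj_eq val_inj) pne.
rewrite -big_split /=; apply: eq_bigr => i _.
rewrite big_mkcondr -big_split /=; apply: eq_bigr => j ij.
rewrite /G'; case: ifP => _; last by rewrite mul1r.
by apply: Gsg; rewrite (inj_eq perm_inj); apply: contraTneq ij => ->; rewrite ltnn.
Qed.

Lemma vandermonde_perm (N : nat) (s : 'S_N) :
  \prod_(i < N) \prod_(j < N | (i < j)%N) ((s j : nat)%:R - (s i : nat)%:R) =
  (-1) ^+ s * \prod_(i < N) \prod_(j < N | (i < j)%N) ((j : nat)%:R - (i : nat)%:R) :> rat.
Proof.
pose a t : 'rV[rat]_N := \row_i (t i : nat)%:R.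
have vE (t : 'I_N -> 'I_N) : \prod_(i < N) \prod_(j < N | (i < j)%N)
    ((t j : nat)%:R - (t i : nat)%:R) = \det (Vandermonde N (a t)).
  by rewrite det_Vandermonde; apply: eq_bigr => i _; apply: eq_bigr => j _; rewrite !mxE.
rewrite (vE s) (vE id) mulrC -[(-1) ^+ s](det_perm rat s) -[\det (perm_mx s)]det_tr -det_mulmx.
rewrite tr_perm_mx -col_permE; congr (\det _); apply/matrixP => i j; rewrite !mxE.
by [].
Qed.

Lemma vandermonde_neq0 (N : nat) :
  \prod_(i < N) \prod_(j < N | (i < j)%N) ((j : nat)%:R - (i : nat)%:R) != 0 :> rat.
Proof.
apply/prodf_neq0 => i _; apply/prodf_neq0 => j ij.
by rewrite subr_eq0 eqr_nat neq_ltn ij orbT.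
Qed.

(* Factor of the weight of a map [j |-> (letter, index)] at a pair of          *)
(* positions. It need only change by the Koszul sign when the two are swapped; *)
(* with a difference instead of a sign inside one letter, the product over all *)
(* pairs is a Vandermonde determinant, whose behaviour under permutations of   *)
(* the indices is known.                                                       *)
Definition pair_weight (a b : (nat + nat) * nat) : rat :=
  match a.1, b.1 with
  | inr m, inr m' => if m == m' then b.2%:R - a.2%:R else if (m < m')%N then 1 else -1
  | _, _ => 1
  end.

Lemma pair_weightC a b :
  pair_weight a b = (-1) ^+ (Qinf_parity a.1 && Qinf_parity b.1) * pair_weight b a.
Proof.
case: a => [[m|m] t]; case: b => [[m'|m'] t'] //=; rewrite ?expr0 ?mul1r //.
rewrite /pair_weight /= expr1 mulN1r eq_sym.
case: eqP => [_|/eqP mm]; first by rewrite opprB.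
by case: (ltngtP m m') mm => //; rewrite opprK.
Qed.

Section Desuperize.
Variables (A : tca) (N : nat) (V : lmodType rat) (v : 'I_N -> nat + nat -> V).

Definition weight n (w : {ffun 'I_n -> nat + nat}) (f : {ffun 'I_n -> 'I_N}) : rat :=
  \prod_(i < n) \prod_(j < n | (i < j)%N) pair_weight (w i, f i : nat) (w j, f j : nat).

Lemma weight_perm n (s : 'S_n) (w : {ffun 'I_n -> nat + nat}) (f : {ffun 'I_n -> 'I_N}) :
  weight [ffun i => w (s i)] [ffun i => f (s i)] = koszul Qinf_parity s w * weight w f.
Proof.
rewrite /weight -(@prod_pairs_perm n s
  (fun i j => (-1) ^+ (Qinf_parity (w i) && Qinf_parity (w j)))
  (fun i j => pair_weight (w i, f i : nat) (w j, f j : nat))).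
  by apply: eq_bigr => i _; apply: eq_bigr => j _; rewrite !ffunE.
by move=> i j _; rewrite pair_weightC.
Qed.

Lemma koszul_sq (B : Type) (p : B -> bool) n (s : 'S_n) w :
  koszul p s w * koszul p s w = 1.
Proof.
rewrite -big_split big1 //= => i _; rewrite -big_split big1 //= => j _.
by rewrite -expr2 sqrr_sign.
Qed.

Definition separates n (w : {ffun 'I_n -> nat + nat}) (f : {ffun 'I_n -> 'I_N}) : bool :=
  [forall i, forall j, (w i == w j) && (f i == f j) ==> (i == j)].

Lemma separatesP n (w : {ffun 'I_n -> nat + nat}) (f : {ffun 'I_n -> 'I_N}) :
  reflect (forall i j, w i = w j -> f i = f j -> i = j) (separates w f).
Proof.
apply: (iffP forallP) => [h i j wij fij|h i].
  by have /forallP /(_ j) := h i; rewrite wij fij !eqxx => /eqP.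
by apply/forallP => j; apply/implyP => /andP[/eqP wij /eqP fij]; apply/eqP/h.
Qed.

(** Polarization that forgets parities: the occurrences of a letter receive distinct indices in all
    ways, and [weight] compensates the Koszul sign. Being balanced, it descends to a linear map on
    the super evaluation. *)
Definition desuper n (y : A 'rV[rat]_n) (w : {ffun 'I_n -> nat + nat}) : A V :=
  \sum_(f | separates w f) weight w f *: plug y (fun j => v (f j) (w j)).

Lemma balanced_desuper : balanced Qinf_parity desuper.
Proof.
split=> [n a y z w _ _|n s y w _].
  rewrite /desuper scaler_sumr -big_split; apply: eq_bigr => f _ /=.
  by rewrite /plug linearP scalerDr !scalerA mulrC.
rewrite /desuper scaler_sumr.
pose h (s : 'S_n) (f : {ffun 'I_n -> 'I_N}) := [ffun i => f (s i)].
rewrite [RHS](reindex (h s)) /=; last first.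
  by exists (h s^-1%g) => f _; apply/ffunP => i; rewrite !ffunE ?permK ?permKV.
apply: eq_big => [f|f _].
  apply/separatesP/separatesP => hf i j.
    by rewrite !ffunE => wij fij; apply: (@perm_inj _ s); exact: hf.
  move=> wij fij; apply: (@perm_inj _ s^-1%g); apply: hf; rewrite !ffunE ?permKV //.
rewrite weight_perm scalerA mulrA koszul_sq mul1r plug_relabel; congr (_ *: _).
by apply: eq_plug => i; rewrite !ffunE.
Qed.

End Desuperize.

Lemma index_pair_subproof N d (i : 'I_N) (q : 'I_d) : (i * d + q < N * d)%N.
Proof.
apply: leq_trans (_ : i.+1 * d <= _)%N; last by rewrite leq_mul2r ltn_ord orbT.
by rewrite mulSn addnC ltn_add2r.
Qed.

(** * Powers of a pure tensor whose word has distinct letters *)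

Section GenericPower.
Variables (A : tca) (d : nat) (x : A 'rV[rat]_d) (hx : multiweight1 x).
Variable eps : 'I_d -> bool.

Definition letter (q : 'I_d) : nat + nat := if eps q then inr (q : nat) else inl (q : nat).

Lemma letter_inj : injective letter.
Proof.
by move=> q q'; rewrite /letter; case: (eps q); case: (eps q') => // -[/val_inj].
Qed.

Definition generic_tensor : tensor A (nat + nat) := Tensor hx [ffun q => letter q].

Definition tpow (N : nat) : tensor A (nat + nat) :=
  iter N (tensor_mul generic_tensor) (tensor_one A (nat + nat)).

Lemma tclass_tpow N :
  tclass Qinf_parity [:: generic_tensor] ^+ N = tclass Qinf_parity [:: tpow N].
Proof. by elim: N => [//|N IHN]; rewrite exprS IHN -tclassM. Qed.

Lemma tdeg_tpow N : tdeg (tpow N) = (N * d)%N.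
Proof. by elim: N => [//|N IHN]; rewrite mulSn -IHN. Qed.

(** The word of [tpow N] consists of [N] blocks of length [d]; this is place [q] of block [i]. *)
Definition slot N (i : 'I_N) (q : 'I_d) : 'I_(tdeg (tpow N)) :=
  cast_ord (esym (tdeg_tpow N)) (Ordinal (index_pair_subproof i q)).

Lemma slot0 N q : slot (@ord0 N) q = lshift (tdeg (tpow N)) q.
Proof. exact: val_inj. Qed.

Lemma slotS N (i : 'I_N) q : slot (lift ord0 i) q = rshift d (slot i q).
Proof. by apply: val_inj; rewrite /= /bump /= mulnDl mul1n addnA. Qed.

Lemma slot_lt N (i i' : 'I_N) q : (slot i q < slot i' q)%N = (i < i')%N.
Proof.
have d0 : (0 < d)%N by exact: leq_ltn_trans (ltn_ord q).
by rewrite /= ltn_add2r ltn_pmul2r.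
Qed.

Lemma slot_bij N : bijective (fun p : 'I_N * 'I_d => slot p.1 p.2).
Proof.
apply: inj_card_bij; last by rewrite card_prod !card_ord tdeg_tpow.
move=> [i q] [i' q'] /(congr1 val) /= h; congr (_, _); apply: val_inj => /=.
  have d0 : (0 < d)%N by exact: leq_ltn_trans (ltn_ord q).
  by have := congr1 (divn^~ d) h; rewrite !divnMDl // !divn_small ?addn0.
by have := congr1 (modn^~ d) h; rewrite !modnMDl !modn_small.
Qed.

Lemma slotP N (j : 'I_(tdeg (tpow N))) : exists i q, j = slot i q.
Proof. by have [g _ gK] := slot_bij N; exists (g j).1, (g j).2; rewrite -[LHS]gK. Qed.

Lemma slot_inj N (i i' : 'I_N) q q' : slot i q = slot i' q' -> i = i' /\ q = q'.
Proof.
pose sl (p : 'I_N * 'I_d) := slot p.1 p.2.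
by move=> h; have [] := bij_inj (slot_bij N) (h : sl (i, q) = sl (i', q')).
Qed.

Lemma tword_tpow N (i : 'I_N) q : tword (tpow N) (slot i q) = letter q.
Proof.
elim: N i => [[]//|N IHN] i.
case: (unliftP ord0 i) => [j|] ->; rewrite ?slot0 ?slotS.
  by rewrite [tword _]/= wcatr IHN.
by rewrite [tword _]/= wcatl ffunE.
Qed.

Lemma plug_tpow N (V : lmodType rat) (u : 'I_(tdeg (tpow N)) -> V) :
  plug (tcoef (tpow N)) u = \tprod_(i < N) plug x (fun q => u (slot i q)).
Proof.
elim: N u => [|N IHN] u; first by rewrite big_ord0; exact: tone_natural.
rewrite big_ord_recl /plug /= tmul_natural -!/(plug _ _) !plug_relabel IHN.
congr tmul; first by apply: eq_plug => q; rewrite slot0.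
by apply: eq_bigr => i _; apply: eq_plug => q; rewrite slotS.
Qed.

Lemma unslot_exists N : {g | cancel (fun p : 'I_N * 'I_d => slot p.1 p.2) g
  & cancel g (fun p : 'I_N * 'I_d => slot p.1 p.2)}.
Proof. by apply: cid2; have [g gK Kg] := slot_bij N; exists g. Qed.

Definition unslot N := s2val (unslot_exists N).

Lemma slotK N (i : 'I_N) q : unslot (slot i q) = (i, q).
Proof. exact: (s2valP (unslot_exists N)) (i, q). Qed.

Definition slot_map N (s : {ffun 'I_d -> 'S_N}) : {ffun 'I_(tdeg (tpow N)) -> 'I_N} :=
  [ffun j => s (unslot j).2 (unslot j).1].

Lemma slot_mapE N (s : {ffun 'I_d -> 'S_N}) i q : slot_map s (slot i q) = s q i.
Proof. by rewrite ffunE slotK. Qed.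

Lemma slot_map_inj N : injective (@slot_map N).
Proof.
move=> s t st; apply/ffunP => q; apply/permP => i.
by rewrite -!slot_mapE st.
Qed.

(** Each letter fills exactly [N] slots, so giving these distinct indices among [N] amounts to one
    permutation per letter. *)
Lemma separates_slot_map N :
  [set f | separates (tword (tpow N)) f] = @slot_map N @: setT.
Proof.
apply/setP => f; rewrite inE; apply/separatesP/imsetP => [hf|[s _ ->] j j'].
  have finj q : injective (fun i => f (slot i q)).
    by move=> i i' /(hf (slot i q) (slot i' q));
      rewrite !tword_tpow => /(_ erefl) /slot_inj [].
  exists [ffun q => perm (finj q)] => //; apply/ffunP => j.
  by have [i [q ->]] := slotP j; rewrite slot_mapE ffunE permE.
have [i [q ->]] := slotP j; have [i' [q' ->]] := slotP j'.
by rewrite !tword_tpow !slot_mapE => /letter_inj -> /perm_inj ->.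
Qed.

(** Pairs of slots with different letters contribute signs independent of [s]. Pairs with the same
    letter contribute 1 if it is even and, if it is odd, a Vandermonde product in permuted indices,
    which yields the sign of [s q]. *)
Lemma weight_slot_map N : exists2 C : rat, C != 0 &
  forall s : {ffun 'I_d -> 'S_N},
  weight (tword (tpow N)) (slot_map s) = C * \prod_q psign (eps q) (s q).
Proof.
pose vdm : rat := \prod_(i < N) \prod_(j < N | (i < j)%N) ((j : nat)%:R - (i : nat)%:R).
pose mixed := \prod_(p : 'I_N * 'I_d) \prod_(p' : 'I_N * 'I_d |
  (slot p.1 p.2 < slot p'.1 p'.2)%N && (p.2 != p'.2))
  pair_weight (letter p.2, 0%N) (letter p'.2, 0%N).
exists (mixed * \prod_q (if eps q then vdm else 1)).
  rewrite mulf_neq0 //.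
    apply/prodf_neq0 => p _; apply/prodf_neq0 => p' /andP[_ /negPf pp'].
    rewrite /letter; case: (eps _); case: (eps _) => //; rewrite /pair_weight /=.
    by rewrite (inj_eq val_inj) pp'; case: ifP.
  by apply/prodf_neq0 => q _; case: ifP => _ //; exact: vandermonde_neq0.
move=> s; rewrite /weight.
rewrite (reindex _ (onW_bij _ (slot_bij N))) /=.
under eq_bigr => p _ do rewrite (reindex _ (onW_bij _ (slot_bij N))) /=.
under eq_bigr => p _.
  rewrite (bigID (fun p' : 'I_N * 'I_d => p.2 != p'.2)) /=.
  over.
rewrite big_split /= -mulrA; congr (_ * _).
  apply: eq_bigr => p _; apply: eq_bigr => p' /andP[_ pp'].
  rewrite !tword_tpow /letter; move: pp'; rewrite -(inj_eq val_inj) => /negPf pp'.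
  by case: (eps _); case: (eps _) => //; rewrite /pair_weight /= pp'.
rewrite -big_split /=.
transitivity (\prod_(q < d) \prod_(i < N) \prod_(j < N | (i < j)%N)
    (if eps q then ((s q j : nat)%:R - (s q i : nat)%:R) else 1 : rat)).
  rewrite exchange_big pair_bigA /=; apply: eq_bigr => -[i q] _ /=.
  rewrite (reindex_onto (fun i' => (i', q)) fst) /=; last first.
    by move=> [i' q'] /= /andP[_]; rewrite negbK => /eqP ->.
  apply: eq_big => [i'|i' _]; first by rewrite slot_lt !eqxx /= !andbT.
  rewrite !tword_tpow !slot_mapE /letter; case: (eps q) => //.
  by rewrite /pair_weight /= eqxx.
apply: eq_bigr => q _; rewrite /psign; case: (eps q) => /=.
  by rewrite vandermonde_perm mulrC.
by rewrite mul1r big1 // => i _; rewrite big1.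
Qed.

Lemma power_vanishes (J : subrep A) N (V : lmodType rat) (v : 'I_N -> 'I_d -> V) :
  at_Qinf J (tclass Qinf_parity [:: generic_tensor] ^+ N) ->
  J V (\sum_(s : {ffun 'I_d -> 'S_N}) (\prod_q psign (eps q) (s q)) *:
    \tprod_(i < N) plug x (fun q => v (s q i) q)).
Proof.
move=> [s [Js]]; rewrite tclass_tpow => /tclassP h.
(* Letters numbered [d] or more do not occur in [tpow N]; they get the default 0. *)
pose v' t (b : nat + nat) : V := let m := match b with inl m | inr m => m end in
  if insub m is Some q then v t q else 0.
have v'E t q : v' t (letter q) = v t q.
  by rewrite /v' /letter; case: (eps q); rewrite valK.
have := h _ _ (balanced_desuper A v'); rewrite /tsum big_seq1.
have [C C0 wE] := weight_slot_map N.
move=> E; apply: (subspaceZ_inv (subspace_subrep J V) C0).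
have -> : C *: (\sum_(s : {ffun 'I_d -> 'S_N}) (\prod_q psign (eps q) (s q)) *:
    \tprod_(i < N) plug x (fun q => v (s q i) q)) =
      desuper v' (tcoef (tpow N)) (tword (tpow N)).
  rewrite /desuper (eq_bigl (mem (@slot_map N @: setT))) => [|f]; last first.
    by rewrite /= -separates_slot_map inE.
  rewrite big_imset /= => [|? ? _ _]; last exact: slot_map_inj.
  rewrite scaler_sumr; apply: eq_big => [t|t _]; first by rewrite inE.
  rewrite scalerA wE plug_tpow; congr (_ *: _); apply: eq_bigr => i _.
  by apply: eq_plug => q; rewrite tword_tpow v'E slot_mapE.
rewrite E big_seq; apply: (subspace_sum (subspace_subrep J V)) => t ts.
apply: (subspace_sum (subspace_subrep J V)) => f _.
by apply/(subspaceZ (subspace_subrep J V))/subrep_plug/Js.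
Qed.

End GenericPower.

(** * From full symmetrizations to equivariant coefficients *)

Section ExtendPerm.
Variables (N : nat) (T : finType) (th : 'I_N -> T).
Hypothesis thI : injective th.

Definition ext_fun (s : 'S_N) (t : T) : T :=
  if [pick i | th i == t] is Some i then th (s i) else t.

Lemma ext_funE s i : ext_fun s (th i) = th (s i).
Proof.
by rewrite /ext_fun; case: pickP => [j /eqP /thI -> //|/(_ i)]; rewrite eqxx.
Qed.

Lemma ext_fun_out s t : (forall i, th i != t) -> ext_fun s t = t.
Proof. by move=> ht; rewrite /ext_fun; case: pickP => // j; rewrite (negPf (ht j)). Qed.

Lemma image_or_not t : (exists i, t = th i) \/ (forall i, th i != t).
Proof.
case: (pickP (fun i => th i == t)) => [i /eqP <-|h]; first by left; exists i.
by right => i; rewrite h.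
Qed.

Lemma ext_fun_inj s : injective (ext_fun s).
Proof.
move=> t u; have [[i ->]|ht] := image_or_not t; have [[j ->]|hu] := image_or_not u.
- by rewrite !ext_funE => /thI /perm_inj ->.
- by rewrite ext_funE (ext_fun_out s hu) => h; have := hu (s i); rewrite h eqxx.
- by rewrite ext_funE (ext_fun_out s ht) => h; have := ht (s j); rewrite h eqxx.
by rewrite !ext_fun_out.
Qed.

Definition ext_perm s : {perm T} := perm (@ext_fun_inj s).

Lemma ext_permE s i : ext_perm s (th i) = th (s i).
Proof. by rewrite permE ext_funE. Qed.

Lemma ext_perm_out s t : (forall i, th i != t) -> ext_perm s t = t.
Proof. by move=> ht; rewrite permE ext_fun_out. Qed.

Lemma ext_permM s t : ext_perm (s * t) = (ext_perm s * ext_perm t)%g.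
Proof.
apply/permP => u; rewrite permM; have [[i ->]|hu] := image_or_not u.
  by rewrite !ext_permE permM.
by rewrite !ext_perm_out.
Qed.

Lemma ext_tperm i j : ext_perm (tperm i j) = tperm (th i) (th j).
Proof.
apply/permP => u; have [[k ->]|hu] := image_or_not u.
  rewrite ext_permE; case: tpermP => [->|->|/eqP ik /eqP jk]; rewrite ?tpermL ?tpermR //.
  by rewrite tpermD // (inj_eq thI) eq_sym.
by rewrite ext_perm_out // tpermD.
Qed.

Lemma odd_ext_perm s : ext_perm s = s :> bool.
Proof.
have [ts -> _] := prod_tpermP s; elim: ts => [|[i j] ts IHts].
  rewrite !big_nil odd_perm1 (_ : ext_perm 1 = 1%g) ?odd_perm1 //.
  by apply: (mulgI (ext_perm 1)); rewrite -ext_permM !mulg1.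
by rewrite !big_cons ext_permM !odd_permM IHts ext_tperm !odd_tperm (inj_eq thI).
Qed.

Lemma perm_on_ext (S : {set T}) s : (forall i, th i \in S) -> perm_on S (ext_perm s).
Proof.
move=> hS; apply/subsetP => t; rewrite inE; have [[i ->] //|ht] := image_or_not t.
by rewrite ext_perm_out ?eqxx.
Qed.

End ExtendPerm.

Section Averaging.
Variables (A : tca) (J : subrep A) (hJ : GL_ideal J) (d : nat) (x : A 'rV[rat]_d).

Lemma equivariant_all eps (T : finType) (S : {set T}) (V : lmodType rat)
    (c : {ffun 'I_d -> {perm T}} -> A V) (r s : {ffun 'I_d -> {perm T}}) :
  equivariant d eps S c -> (forall q, perm_on S (r q)) ->
  c [ffun q => r q * s q]%g = (\prod_q psign (eps q) (r q)) *: c s.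
Proof.
move=> hc hr.
have H (l : seq 'I_d) : uniq l ->
    c [ffun q => if q \in l then r q * s q else s q]%g =
    (\prod_(q <- l) psign (eps q) (r q)) *: c s.
  elim: l => [_|q l IHl /= /andP[ql /IHl E]].
    by rewrite big_nil scale1r; congr c; apply/ffunP => q; rewrite ffunE.
  rewrite big_cons -scalerA -E -(hc q _ (r q)) //; congr c; apply/ffunP => p.
  by rewrite !ffunE in_cons; case: eqP => [->|//]; rewrite (negPf ql).
rewrite -[\prod_q _]big_enum -H ?enum_uniq //; congr c.
by apply/ffunP => q; rewrite !ffunE mem_enum.
Qed.

(** Averaging over d-tuples of permutations of [S]: a translation changes [c] only by signs, so up
    to a nonzero factor each product may be replaced by the signed sum of its translates. That sum
    is in [J] by hypothesis, and [J] is an ideal. *)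
Lemma vanishes_average eps N :
  (forall (V : lmodType rat) (v : 'I_N -> 'I_d -> V),
    J V (\sum_(s : {ffun 'I_d -> 'S_N}) (\prod_q psign (eps q) (s q)) *:
      \tprod_(i < N) plug x (fun q => v (s q i) q))) ->
  vanishes J x d eps N.
Proof.
move=> H T S V v c hS hc.
case: N / hS H => H.
pose th : 'I_#|S| -> T := @enum_val _ (mem S).
have thI : injective th by exact: enum_val_inj.
pose X := {ffun 'I_d -> 'S_#|S|}.
pose r (p : X) : {ffun 'I_d -> {perm T}} := [ffun q => ext_perm thI (p q)].
have hr p q : perm_on S (r p q) by rewrite ffunE; apply: perm_on_ext => i; exact: enum_valP.
pose m (s : {ffun 'I_d -> {perm T}}) := \tprod_(i in S) plug x (fun q => v (s q i) q).
have n0 : #|X|%:R != 0 :> rat.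
  by rewrite pnatr_eq0 -lt0n; apply/card_gt0P; exists [ffun=> 1%g].
apply: (subspaceZ_inv (subspace_subrep J V) n0).
have -> : #|X|%:R *: \sum_s tmul (c s) (m s) = \sum_s tmul (c s)
    (\sum_(p : X) (\prod_q psign (eps q) (p q)) *: m [ffun q => r p q * s q]%g).
  rewrite scaler_nat -sumr_const.
  under [RHS]eq_bigr => s _ do rewrite tmulC tmul_suml.
  rewrite [RHS]exchange_big; apply: eq_bigr => p _ /=.
  pose h (p : X) (s : {ffun 'I_d -> {perm T}}) : {ffun 'I_d -> {perm T}} :=
    [ffun q => r p q * s q]%g.
  rewrite (reindex (h p)) /=; last first.
    exists (fun s => [ffun q => (r p q)^-1 * s q]%g) => s _; apply/ffunP => q;
      by rewrite !ffunE ?mulKg ?mulKVg.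
  apply: eq_bigr => s _; rewrite (equivariant_all _ hc) //.
  rewrite !tmulZl [RHS]/=; congr (_ *: _); last exact: tmulC.
  by apply: eq_bigr => q _; rewrite ffunE /psign odd_ext_perm.
apply: (subspace_sum (subspace_subrep J V)) => s _; apply: hJ.
have := H V (fun i q => v (s q (th i)) q); congr (J V _).
apply: eq_bigr => p _; congr (_ *: _); rewrite /m [RHS]big_enum_val /=.
by apply: eq_bigr => i _; apply: eq_plug => q; rewrite !ffunE permM ext_permE.
Qed.

Lemma radical_products (hx : multiweight1 x) :
  (forall eps, radical (at_Qinf J) (tclass Qinf_parity [:: generic_tensor hx eps])) ->
  exists N, forall (V : lmodType rat) (v : 'I_N -> 'I_d -> V),
    J V (\tprod_(i < N) plug x (v i)).
Proof.
move=> H; apply: vanishes_all => eps; have [N hN] := H eps.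
by exists N; apply: vanishes_average => V v; exact: power_vanishes hN.
Qed.

End Averaging.

(** * Nilpotent subrepresentations *)

Section Nilpotent.
Local Open Scope classical_set_scope.
Variable A : tca.

Fixpoint is_prod (S : subrep A) (n : nat) (V : lmodType rat) (y : A V) : Prop :=
  if n is m.+1 then exists a z, [/\ S V a, is_prod S m z & y = tmul a z]
  else y = tone A V.

Lemma is_prod_fmap S n (V W : lmodType rat) (f : {linear V -> W}) (y : A V) :
  is_prod S n y -> is_prod S n (fmap A f y).
Proof.
elim: n y => [y ->|n IHn y [a [z [Sa /IHn Sz ->]]]]; first exact: tone_natural.
exists (fmap A f a), (fmap A f z); rewrite tmul_natural; split=> //.
exact: subrep_fmap.
Qed.

Lemma is_prodP S n (V : lmodType rat) (y : A V) :
  is_prod S n y <-> exists2 t : n.-tuple (A V),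
    forall i, S V (tnth t i) & y = foldr (@tmul A V) (tone A V) t.
Proof.
elim: n y => [|n IHn] y.
  split=> [->|[t _ ->]]; last by rewrite tuple0.
  by exists [tuple] => // -[].
split=> [[a [z [Sa /IHn [t St ->] ->]]]|[t St ->]].
  exists (cons_tuple a t) => // i; case: (unliftP ord0 i) => [j|] ->.
    by rewrite tnthS.
  by rewrite tnth0.
case: (tupleP t) St => a t' St /=; exists a, (foldr (@tmul A V) (tone A V) t'); split=> //.
  by have := St ord0; rewrite tnth0.
by apply/IHn; exists t' => // i; have := St (lift ord0 i); rewrite tnthS.
Qed.

Definition nilpotent_mod (J S : subrep A) (n : nat) : Prop :=
  forall (V : lmodType rat) (y : A V), is_prod S n y -> J V y.

Lemma nilpotent_modP (J S : subrep A) n :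
  (forall V : lmodType rat, subrep_pow S n V `<=` J V) <-> nilpotent_mod J S n.
Proof.
split=> [h V y /is_prodP [t St ->]|h V y [k [c [s [Ss ->]]]]].
  apply: h; exists 1%N, (fun=> 1), (fun=> t); split=> //.
  by rewrite big_ord1 scale1r.
apply: (subspace_sum (subspace_subrep J V)) => i _.
apply: (subspaceZ (subspace_subrep J V)); apply: h; apply/is_prodP.
by exists (s i).
Qed.

Definition zero_subrep : subrep A.
Proof.
exists (fun V y => y = 0) => [//|V a y z -> ->|V W f y ->].
  by rewrite scaler0 addr0.
exact: linear0.
Defined.

Definition sum_subrep (S1 S2 : subrep A) : subrep A.
Proof.
exists (fun V y => exists y1 y2, [/\ S1 V y1, S2 V y2 & y = y1 + y2])
  => [V|V a y z [y1 [y2 [h1 h2 ->]]] [z1 [z2 [k1 k2 ->]]]|V W f y [y1 [y2 [h1 h2 ->]]]].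
- by exists 0, 0; rewrite addr0; split=> //; exact: subrep0.
- exists (a *: y1 + z1), (a *: y2 + z2); split; [exact: subrep_lin|exact: subrep_lin|].
  by rewrite scalerDr addrACA.
by exists (fmap A f y1), (fmap A f y2); rewrite linearD; split=> //; exact: subrep_fmap.
Defined.

(** The span of the values of [x], as an intersection of subspaces, so that membership is its own
    induction principle. *)
Definition generated n (x : A 'rV[rat]_n) : subrep A.
Proof.
exists (fun V y => forall K : A V -> Prop, subspace K -> (forall v, K (plug x v)) -> K y)
  => [V K hK _|V a y z hy hz K hK h|V W f y hy K hK h].
- exact: hK.1.
- by apply: hK.2; [exact: hy | exact: hz].
apply: (hy (fun z => K (fmap A f z))) => [|v]; last by rewrite fmap_plug.
by split=> [|a z w hz hw]; rewrite ?linear0 ?linearP; [exact: hK.1 | exact: hK.2].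
Defined.

Section Ideal.
Variables (J : subrep A) (hJ : GL_ideal J).

Lemma nilpotent_mod_leq S n p (V : lmodType rat) (y : A V) :
  nilpotent_mod J S n -> (n <= p)%N -> is_prod S p y -> J V y.
Proof.
move=> hS; elim: p y => [|p IHp] y;
  first by rewrite leqn0 => /eqP n0 hy; apply: hS; rewrite n0.
rewrite leq_eqVlt => /orP[/eqP <- /hS //|np [a [z [_ Sz ->]]]].
by apply: hJ; exact: IHp.
Qed.

Lemma nilpotent_mod_zero : nilpotent_mod J zero_subrep 1.
Proof. by move=> V y [a [z [-> _ ->]]]; rewrite tmul0l; exact: subrep0. Qed.

Lemma nilpotent_mod_sum S1 S2 n1 n2 :
  nilpotent_mod J S1 n1 -> nilpotent_mod J S2 n2 ->
  nilpotent_mod J (sum_subrep S1 S2) (n1 + n2).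
Proof.
move=> h1 h2 V y hy; rewrite -[y]tmul1 tmulC -[tone A V]tmul1.
(* [l] factors are still to be expanded, [p] are already sorted into [S1] and [q] into [S2]; at
   [l = 0], either [p] reaches [n1] or [q] reaches [n2]. *)
have H l p q (f g h : A V) : is_prod (sum_subrep S1 S2) l f -> is_prod S1 p g ->
    is_prod S2 q h -> (n1 + n2 <= l + (p + q))%N -> J V (tmul f (tmul g h)).
  elim: l f p q g h => [f p q g h -> hg hh|l IHl f p q g h].
    rewrite add0n tmul1 => npq; have [np|pn] := leqP n1 p.
      by rewrite tmulC; apply: hJ; exact: nilpotent_mod_leq np hg.
    apply: hJ; apply: nilpotent_mod_leq h2 _ hh.
    by rewrite -(leq_add2l n1); apply: leq_trans npq _; rewrite leq_add2r ltnW.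
  move=> [a [f' [[a1 [a2 [ha1 ha2 ->]]] hf' ->]]] hg hh npq.
  have -> : tmul (tmul (a1 + a2) f') (tmul g h) =
      tmul f' (tmul (tmul a1 g) h) + tmul f' (tmul g (tmul a2 h)).
    rewrite [tmul (_ + _) f']tmulC -tmulA tmulDl tmulDr tmulA.
    by rewrite [tmul a2 (tmul g h)]tmulA [tmul a2 g]tmulC !tmulA.
  apply: (subspaceD (subspace_subrep J V)).
    apply: (IHl f' p.+1 q) => //; first by exists a1, g.
    by rewrite addSn addnS -addSn.
  apply: (IHl f' p q.+1) => //; first by exists a2, h.
  by rewrite !addnS -addSn.
exact: (H _ 0%N 0%N _ _ _ hy erefl erefl (leq_addr _ _)).
Qed.

(** By linearity in each factor, elements of [generated x] can be replaced one at a time by values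
    [plug x v]. *)
Lemma nilpotent_generated n (x : A 'rV[rat]_n) N :
  (forall (V : lmodType rat) (v : 'I_N -> 'I_n -> V), J V (\tprod_(i < N) plug x (v i))) ->
  nilpotent_mod J (generated x) N.
Proof.
move=> H V y hy; rewrite -[y]tmul1 tmulC.
have G l m (f : A V) (v : 'I_m -> 'I_n -> V) : is_prod (generated x) l f -> (l + m)%N = N ->
    J V (tmul f (\tprod_(i < m) plug x (v i))).
  elim: l m f v => [m f v -> mN|l IHl m f v [a [f' [ha hf' ->]]] lm].
    by rewrite tmul1; move: (H V); rewrite -mN; apply.
  rewrite -tmulA; apply: (ha (fun a => J V (tmul a _))) => [|w].
    split=> [|b y1 y2 h1 h2]; first by rewrite tmul0l; exact: subrep0.
    by rewrite tmul_linear; exact: subrep_lin.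
  rewrite tmulA [tmul _ f']tmulC -tmulA.
  have := IHl m.+1 f' (fun i => if unlift ord0 i is Some j then v j else w) hf'.
  rewrite addnS -addSn lm => /(_ erefl); rewrite big_ord_recl unlift_none.
  by congr (J V (tmul _ (tmul _ _))); apply: eq_bigr => i _; rewrite liftK.
by have := G N 0%N y (fun i => match notF (ltn_ord i) with end) hy (addn0 N); rewrite big_ord0.
Qed.

Lemma GL_radP (V : lmodType rat) (y : A V) :
  GL_rad J V y <-> exists (S : subrep A) (n : nat), nilpotent_mod J S n /\ S V y.
Proof.
split=> [[k [S [z [hS hz ->]]]]|[S [n [hS Sy]]]]; last first.
  exists 1%N, (fun=> S), (fun=> y); split=> // [_|]; last by rewrite big_ord1.
  by exists n => W; apply: (nilpotent_modP J S n).2.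
have {}hS i : exists n, nilpotent_mod J (S i) n.
  by have [n hn] := hS i; exists n; apply/nilpotent_modP.
elim: k S z hS hz => [|k IHk] S z hS hz.
  by exists zero_subrep, 1%N; split; [exact: nilpotent_mod_zero | rewrite big_ord0].
have [S' [n [hS' hz']]] := IHk (fun i => S (lift ord0 i)) _
  (fun i => hS _) (fun i => hz (lift ord0 i)).
have [m hm] := hS ord0.
exists (sum_subrep (S ord0) S'), (m + n)%N; split; first exact: nilpotent_mod_sum.
by rewrite big_ord_recl; exists (z ord0), (\sum_(i < k) z (lift ord0 i)).
Qed.

Lemma subspace_GL_rad (V : lmodType rat) : subspace (GL_rad J V).
Proof.
split=> [|a y z /GL_radP [S [n [hS Sy]]] /GL_radP [S' [n' [hS' Sz]]]].
  by apply/GL_radP; exists zero_subrep, 1%N; split=> //; exact: nilpotent_mod_zero.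
apply/GL_radP; exists (sum_subrep S S'), (n + n')%N; split; first exact: nilpotent_mod_sum.
by exists (a *: y), z; split=> //; exact: (subspaceZ (subspace_subrep S V)).
Qed.

End Ideal.

Lemma super_power (B : Type) (p : B -> bool) (S : subrep A) (s : seq (tensor A B)) n :
  (forall t, t \in s -> S _ (tcoef t)) ->
  exists2 s', forall t, t \in s' -> is_prod S n (tcoef t)
            & tclass p s ^+ n = tclass p s'.
Proof.
move=> hs; elim: n => [|n [s' hs' IHn]].
  by exists [:: tensor_one A B] => // t; rewrite inE => /eqP ->.
exists (sum_mul s s'); last by rewrite exprS IHn -tclassM.
move=> t /allpairsP [[t1 t2] /= [/hs h1 /hs' h2 ->]].
exists (relabel A (@lshift _ _) (tcoef t1)), (relabel A (@rshift _ _) (tcoef t2)).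
by split=> //; [exact: subrep_fmap | exact: is_prod_fmap].
Qed.

Lemma radical_sub_of_GL_rad_sub (I J : subrep A) : GL_ideal J ->
  (forall V : lmodType rat, GL_rad I V `<=` GL_rad J V) ->
  radical (at_Qinf I) `<=` radical (at_Qinf J).
Proof.
move=> hJ IJ x [n [s [sI xE]]].
have [S [N [hS sS]]] : exists S N, nilpotent_mod J S N /\ forall t, t \in s -> S _ (tcoef t).
  elim: s sI {xE} => [_|t s IHs sI].
    by exists zero_subrep, 1%N; split=> //; exact: nilpotent_mod_zero.
  have [|S [N [hS sS]]] := IHs; first by move=> u us; apply: sI; rewrite in_cons us orbT.
  have /IJ /(GL_radP hJ) [S' [N' [hS' tS']]] : GL_rad I _ (tcoef t).
    exists 1%N, (fun=> I), (fun=> tcoef t); split=> [_|_|]; last by rewrite big_ord1.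
    - exists 1%N; apply/nilpotent_modP => V y [a [z [Ia -> ->]]].
      by rewrite tmulC tmul1.
    - by apply: sI; rewrite in_cons eqxx.
  exists (sum_subrep S' S), (N' + N)%N; split; first exact: nilpotent_mod_sum.
  move=> u; rewrite in_cons => /orP[/eqP ->|us].
    by exists (tcoef t), 0; rewrite addr0; split=> //; exact: subrep0.
  by exists 0, (tcoef u); rewrite add0r; split; [exact: subrep0 | exact: sS |].
exists (n * N)%N; rewrite exprM xE; have [s' hs' ->] := super_power Qinf_parity N sS.
by exists s'; split=> // t /hs' /hS.
Qed.

End Nilpotent.

(** * Generation in multiweight (1, ..., 1) *)

Section SubspaceType.
Variables (W : lmodType rat) (K : W -> Prop) (hK : subspace K).

Definition subspace_pred of subspace K : {pred W} := fun w => `[< K w >].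

Lemma subspace_pred_closed : submod_closed (subspace_pred hK).
Proof.
split=> [|a x y /asboolP hx /asboolP hy]; apply/asboolP; first exact: hK.1.
exact: hK.2.
Qed.

HB.instance Definition _ :=
  GRing.isSubmodClosed.Build rat W (subspace_pred hK) subspace_pred_closed.

Record subspace_type := SubspaceType
  { subspace_val :> W; _ : subspace_val \in subspace_pred hK }.

HB.instance Definition _ := [isSub for subspace_val].
HB.instance Definition _ := [Choice of subspace_type by <:].
HB.instance Definition _ := [SubChoice_isSubLmodule of subspace_type by <:].

Lemma subspace_typeP (x : subspace_type) : K (val x).
Proof. by apply/asboolP; exact: (valP x). Qed.

End SubspaceType.

Definition to_linear (V W : lmodType rat) (g : V -> W) (gl : linear g) : {linear V -> W} :=
  HB.pack g (GRing.isLinear.Build rat V W _ g gl).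

(** A maximal subspace avoiding [v] is a complement of its line; the functional is the coefficient
    along [v]. *)
Lemma exists_functional (V : lmodType rat) (v : V) : v != 0 ->
  exists l : {linear V -> rat^o}, l v = 1.
Proof.
move=> v0.
pose P (X : set V) := (forall a x y, X x -> X y -> X (a *: x + y)) /\ ~ X v.
have [|X [[Xl Xv] Xmax]] := @Zorn_bigcup V P.
  move=> F FP Ftot; split=> [a x y [X FX Xx] [Y FY Yy]|[X FX Xv]]; last exact: (FP X FX).2.
  have [XY|YX] := Ftot X Y FX FY.
    by exists Y => //; apply: (FP Y FY).1 => //; exact: XY.
  by exists X => //; apply: (FP X FX).1 => //; exact: YX.
have X0 : X 0.
  apply: contrapT => nX0.
  have Xe x : ~ X x
    by move=> Xx; apply: nX0; have := Xl (-1) x x Xx Xx; rewrite scaleN1r addNr.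
  apply: (Xmax [set 0%R]%classic); first by split=> [x /Xe//|/(_ 0 erefl)].
  by split=> [a x y -> ->|/= /eqP]; [rewrite /= scaler0 addr0 | exact/negP].
have subX : subspace X by [].
have dec u : exists a, X (u - a *: v).
  have [Xu|nXu] := pselect (X u); first by exists 0; rewrite scale0r subr0.
  pose Y : set V := fun w => exists c a, X c /\ w = c + a *: u.
  have YX : (X `<` Y)%classic.
    split=> [x Xx|YX]; first by exists x, 0; rewrite scale0r addr0.
    by apply: nXu; apply: YX; exists 0, 1; rewrite add0r scale1r.
  have [c [a [Xc vE]]] : Y v.
    apply: contrapT => nYv; apply: (Xmax Y YX);
    split=> // a x y [c [b [Xc ->]]] [c' [b' [Xc' ->]]].
    exists (a *: c + c'), (a * b + b'); split; first exact: Xl.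
    by rewrite scalerDl scalerDr scalerA addrACA.
  have a0 : a != 0 by apply: contra_not_neq Xv => a0; rewrite vE a0 scale0r addr0.
  exists a^-1; rewrite vE scalerDr scalerA mulVf // scale1r opprD addrCA subrr addr0 -scaleNr.
  exact: (subspaceZ subX).
have [l hl] := choice dec.
have lU u a : X (u - a *: v) -> l u = a.
  move=> h; apply/eqP; rewrite -subr_eq0; apply: contra_notT Xv => la.
  apply: (subspaceZ_inv subX la).
  by have := subspaceB subX h (hl u); rewrite opprB addrC addrA subrK -scalerBl.
have lin : linear (l : V -> rat^o).
  move=> a u w; apply: lU; rewrite scalerDl -[(_ *: _ : rat^o)]/(a * l u)
    -scalerA opprD addrACA -scalerBr.
  exact: Xl.
exists (to_linear lin).
by apply: lU; rewrite scale1r subrr.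
Qed.

(** Rank one corrections: if the map [P] built so far misses [v] by [r], choose [k] with [k r = 1]
    and add [u |-> k (u - P u) *: r], which is zero wherever [P] is already the identity. *)
Lemma finite_projection (V : lmodType rat) (s : seq V) :
  exists m (g : {linear V -> 'rV[rat]_m}) (f : {linear 'rV[rat]_m -> V}),
  forall v, v \in s -> f (g v) = v.
Proof.
suff [m [l [w h]]] : exists m (l : 'I_m -> {linear V -> rat^o}) (w : 'I_m -> V),
    forall v, v \in s -> \sum_(i < m) l i v *: w i = v.
  pose g (v : V) : 'rV[rat]_m := \row_i l i v.
  have lin : linear g by move=> a u v; apply/rowP => i; rewrite !mxE linearP.
  exists m, (to_linear lin), (lincomb w).
  move=> v /h {2}<-; rewrite /= /lincomb; apply: eq_bigr => i _.
  by rewrite mxE.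
elim: s => [|v s [m [l [w IHs]]]].
  by exists 0%N, (fun=> \0), (fun=> 0).
pose P u := \sum_(i < m) l i u *: w i.
have Plin a u u' : P (a *: u + u') = a *: P u + P u'.
  rewrite /P scaler_sumr -big_split; apply: eq_bigr => i _ /=.
  by rewrite linearP scalerDl scalerA.
pose r := v - P v.
have [r0|r0] := eqVneq r 0.
  exists m, l, w => u; rewrite in_cons => /orP[/eqP ->|/IHs //].
  by apply/esym/eqP; rewrite -subr_eq0; apply/eqP.
have [k kr] := exists_functional r0.
pose k' u : rat^o := k (u - P u).
have lin : linear k'.
  move=> a u u'; rewrite /k' Plin -linearP; congr (k _).
  by rewrite scalerBr opprD addrACA.
exists m.+1, (fun i => if unlift ord0 i is Some j then l j
  else to_linear lin),
  (fun i => if unlift ord0 i is Some j then w j else r) => u hu.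
rewrite big_ord_recl unlift_none /=.
under eq_bigr => i _ do rewrite liftK.
rewrite -/(P u) /k'; move: hu; rewrite in_cons => /orP[/eqP ->|/IHs Pu].
  by rewrite kr scale1r /r subrK.
by rewrite [P u]Pu subrr linear0 scale0r add0r.
Qed.

(** * Multilinear maps and extraction of multilinear coefficients *)

Section Multilinear.
Variables (n : nat) (V W : lmodType rat) (phi : {ffun 'I_n -> V} -> W).
Hypothesis phiP : multilinear phi.

Lemma multilinear0 (v : {ffun 'I_n -> V}) i :
  phi [ffun j => if j == i then 0 else v j] = 0.
Proof.
have /eqP := phiP v i 1 0 0.
by rewrite /= !scale1r addr0 addrC -subr_eq subrr eq_sym => /eqP.
Qed.

Lemma multilinearZ (v : {ffun 'I_n -> V}) (s : 'I_n -> rat) :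
  phi [ffun j => s j *: v j] = (\prod_j s j) *: phi v.
Proof.
have H (l : seq 'I_n) : uniq l ->
    phi [ffun j => if j \in l then s j *: v j else v j] = (\prod_(j <- l) s j) *: phi v.
  elim: l => [_|i l IHl /= /andP[il /IHl E]].
    by rewrite big_nil scale1r; congr phi; apply/ffunP => j; rewrite ffunE.
  rewrite big_cons -scalerA -E.
  have := phiP [ffun j => if j \in l then s j *: v j else v j] i (s i) (v i) 0.
  rewrite /= multilinear0 !addr0 => {}E.
  transitivity (phi [ffun j => if j == i then s i *: v i
      else [ffun j => if j \in l then s j *: v j else v j] j]).
    by congr phi; apply/ffunP => j; rewrite !ffunE in_cons; case: eqP => [->|].
  rewrite E; congr (_ *: phi _); apply/ffunP => j; rewrite !ffunE.
  by case: eqP => [->|//]; rewrite (negPf il).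
rewrite -[\prod_j _]big_enum -H ?enum_uniq //; congr phi.
by apply/ffunP => j; rewrite !ffunE mem_enum.
Qed.

End Multilinear.

Lemma multilinear_span n m (W : lmodType rat) (phi : {ffun 'I_n -> 'rV[rat]_m} -> W)
    (K : W -> Prop) :
  multilinear phi -> subspace K ->
  (forall w : {ffun 'I_n -> 'I_m}, K (phi [ffun j => delta_mx 0 (w j)])) ->
  forall v, K (phi v).
Proof.
move=> phiP hK Kb.
have H k : (k <= n)%N -> forall v : {ffun 'I_n -> 'rV[rat]_m},
    (forall j : 'I_n, (k <= j)%N -> exists i, v j = delta_mx 0 i) -> K (phi v).
  elim: k => [_ v hv|k IHk kn v hv].
    have [w hw] := choice (fun j => hv j (leq0n _)).
    have := Kb [ffun j => w j]; congr (K (phi _)).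
    by apply/ffunP => j; rewrite !ffunE hw.
  pose q := Ordinal kn.
  pose up z : {ffun 'I_n -> 'rV[rat]_m} := [ffun j => if j == q then z else v j].
  have -> : v = up (\sum_(i < m) v q 0 i *: delta_mx 0 i).
    by apply/ffunP => j; rewrite ffunE; case: eqP => // ->; rewrite -row_sum_delta.
  have upK : subspace (fun z => K (phi (up z))).
    split=> [|a x y hx hy]; first by rewrite /up multilinear0 //; exact: hK.1.
    by rewrite /up phiP; exact: hK.2.
  apply: (subspace_sum upK) => i _; apply: (subspaceZ upK).
  apply: IHk => [|j]; first exact: ltnW.
  rewrite leq_eqVlt ffunE => /orP[/eqP kj|kj].
    by rewrite (_ : j == q); [exists i | apply/eqP/val_inj].
  by case: eqP => _; [exists i | exact: hv].
by move=> v; apply: (H n (leqnn n)) => j; rewrite leqNgt ltn_ord.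
Qed.

(** Interpolation at 0, ..., D: the weights extract the linear coefficient of a polynomial of degree
    at most [D], and exist because a Vandermonde matrix is invertible. *)
Lemma extraction_weights (D : nat) :
  {c : 'I_D.+1 -> rat | forall k, (k <= D)%N ->
    \sum_(t < D.+1) c t * (t : nat)%:R ^+ k = (k == 1%N)%:R}.
Proof.
pose M : 'M[rat]_D.+1 := Vandermonde D.+1 (\row_i (i : nat)%:R).
have Mu : M \in unitmx.
  rewrite unitmxE unitfE det_Vandermonde.
  have := vandermonde_neq0 D.+1; congr (_ != 0).
  by apply: eq_bigr => i _; apply: eq_bigr => j _; rewrite !mxE.
pose c := invmx M *m (\col_(k < D.+1) (k == 1%N :> nat)%:R).
exists (fun t => c t 0) => k kD.
have kD' : (k < D.+1)%N by [].
have := congr1 (fun B : 'cV_D.+1 => B (Ordinal kD') 0)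
  (mulKVmx Mu (\col_(k < D.+1) (k == 1%N :> nat)%:R)).
rewrite !mxE /= => <-; apply: eq_bigr => t _; rewrite !mxE mulrC.
by [].
Qed.

Definition ewt D : 'I_D.+1 -> rat := sval (extraction_weights D).
Arguments ewt : clear implicits.

Lemma ewtP D k : (k <= D)%N -> \sum_(t < D.+1) ewt D t * (t : nat)%:R ^+ k = (k == 1%N)%:R.
Proof. exact: (svalP (extraction_weights D)). Qed.

Definition fiber n k (al : 'I_n -> 'I_k) (a : 'I_k) : nat := #|[set j | al j == a]|.

Lemma prod_fiber n k (al : 'I_n -> 'I_k) (s : 'I_k -> rat) :
  \prod_j s (al j) = \prod_a s a ^+ fiber al a.
Proof.
rewrite (partition_big al predT) //=; apply: eq_bigr => a _.
rewrite (eq_bigr (fun=> s a)) => [|j /eqP -> //].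
by rewrite prodr_const; congr (_ ^+ _); apply: eq_card => j; rewrite inE.
Qed.

(** The weights act on each variable separately, on the monomial with exponents [fiber al a], all at
    most [D]. *)
Lemma ewt_prod D n k (al : 'I_n -> 'I_k) : (n <= D)%N ->
  \sum_(t : {ffun 'I_k -> 'I_D.+1}) (\prod_a ewt D (t a)) * \prod_j (t (al j) : nat)%:R =
  ([forall a, fiber al a == 1%N])%:R.
Proof.
move=> nD.
under eq_bigr => t _ do rewrite (prod_fiber al (fun a => (t a : nat)%:R)) -big_split /=.
rewrite -(bigA_distr_bigA (fun a (i : 'I_D.+1) => ewt D i * (i : nat)%:R ^+ fiber al a)) /=.
under eq_bigr => a _.
  rewrite ewtP; last by apply: leq_trans nD; rewrite -[X in (_ <= X)%N]card_ord max_card.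
  over.
case: forallP => [h|h]; first by rewrite big1 // => a _; rewrite h.
have [a ha] : exists a, fiber al a != 1%N.
  by apply: contrapT => na; apply: h => a; apply: contrapT => /negP ha; apply: na; exists a.
by rewrite (bigD1 a) //= (negPf ha) mul0r.
Qed.

Lemma fiber_deg n k (al : 'I_n -> 'I_k) : [forall a, fiber al a == 1%N] -> n = k.
Proof.
move=> /forallP h; have := sum1_card 'I_n; rewrite card_ord => <-.
rewrite (partition_big al predT) //= -[RHS]card_ord -sum1_card.
apply: eq_bigr => a _; rewrite sum1_card -(eqP (h a)).
by apply: eq_card => j; rewrite inE.
Qed.

Lemma fiber1_inj n (al : {ffun 'I_n -> 'I_n}) : [forall a, fiber al a == 1%N] = injectiveb al.
Proof.
apply/forallP/injectiveP => [h i j ij|h a].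
  have /cards1P [l hl] := h (al i).
  have /set1P -> : i \in [set l] by rewrite -hl inE.
  by have /set1P -> : j \in [set l] by rewrite -hl inE ij.
apply/cards1P; exists (invF h a); apply/setP => j; rewrite !inE.
by apply/eqP/eqP => [<-|->]; rewrite ?invF_f ?f_invF.
Qed.

(** Expanding the product over [j] chooses [al] with [u \o al = w]. By [ewt_prod] only bijections
    survive, so [k = n]; each of the [n!] bijections determines [u], which cancels the factorial. *)
Lemma resolution_identity D n m (w : 'I_n -> 'I_m) : (n <= D)%N ->
  \sum_(k < D.+1) (k`!)%:R^-1 * (\sum_(u : {ffun 'I_k -> 'I_m})
    \sum_(t : {ffun 'I_k -> 'I_D.+1}) (\prod_a ewt D (t a)) *
      \prod_j \sum_(a | u a == w j) (t a : nat)%:R) = 1 :> rat.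
Proof.
move=> nD.
have inner k (u : {ffun 'I_k -> 'I_m}) :
    \sum_(t : {ffun 'I_k -> 'I_D.+1}) (\prod_a ewt D (t a)) *
      \prod_j \sum_(a | u a == w j) (t a : nat)%:R =
    \sum_(al : {ffun 'I_n -> 'I_k} | [forall j, u (al j) == w j])
      ([forall a, fiber al a == 1%N])%:R.
  under eq_bigr => t _ do rewrite bigA_distr_big_dep /= mulr_sumr.
  rewrite exchange_big; apply: eq_big => [al|al _]; last exact: ewt_prod.
  exact/familyP/forallP.
under eq_bigr => k _ do under eq_bigr => u _ do rewrite inner.
have nD' : (n < D.+1)%N by [].
rewrite (bigD1 (Ordinal nD')) //= [X in _ + X]big1 ?addr0 => [|k /eqP kn]; last first.
  rewrite big1 ?mulr0 // => u _; rewrite big1 // => al _.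
  by case h : [forall a, _] => //; case: kn; apply: val_inj; rewrite /= (fiber_deg h).
suff -> : \sum_(u : {ffun 'I_n -> 'I_m})
    \sum_(al : {ffun 'I_n -> 'I_n} | [forall j, u (al j) == w j])
      ([forall a, fiber al a == 1%N])%:R = (n`!)%:R :> rat.
  by rewrite mulVf // pnatr_eq0 -lt0n fact_gt0.
rewrite (exchange_big_dep predT) //=.
rewrite (eq_bigr (fun al : {ffun 'I_n -> 'I_n} => (injectiveb al)%:R)) => [|al _].
  rewrite -natr_sum; congr (_%:R); rewrite -big_mkcond /= sum1_card.
  have := card_inj_ffuns 'I_n 'I_n; rewrite card_ord ffactnn => <-.
  by apply: eq_card => al; rewrite inE.
rewrite fiber1_inj; case: (boolP (injectiveb al)) => [/injectiveP inj|_]; last by rewrite big1.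
rewrite (big_pred1 [ffun a => w (invF inj a)]) // => u.
apply/forallP/eqP => [h|-> j]; last by rewrite ffunE invF_f.
by apply/ffunP => a; rewrite ffunE -(eqP (h _)) f_invF.
Qed.

Section Operators.
Variable F : vfunctor.

(* The projection onto multiweight (1, ..., 1), in degrees at most [D]. *)
Definition mproj D k (y : F 'rV[rat]_k) : F 'rV[rat]_k :=
  \sum_(t : {ffun 'I_k -> 'I_D.+1}) (\prod_a ewt D (t a)) *:
    mxmap F (diag_mx (\row_a (t a : nat)%:R)) y.

Definition coord_copy k m (u : {ffun 'I_k -> 'I_m}) : 'M[rat]_(m, k) :=
  \matrix_(i, a) (u a == i)%:R.

(* On a word e_{w_0} \otimes ... \otimes e_{w_{k-1}} only the [k]-th term of    *)
(* the sum survives; there [mproj] keeps the words of distinct letters, one for *)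
(* each of the [k`!] pairs of a bijection [al] and the map [u] with            *)
(* [u \o al = w], and all of them are sent back to the word [w].               *)
Definition resolve D m (y : F 'rV[rat]_m) : F 'rV[rat]_m :=
  \sum_(k < D.+1) (k`!)%:R^-1 *: \sum_(u : {ffun 'I_k -> 'I_m})
    plug (mproj D (mxmap F (coord_copy u) y)) (fun a => delta_mx 0 (u a)).

Lemma resolveE D m (y : F 'rV[rat]_m) : resolve D y =
  \sum_(k < D.+1) (k`!)%:R^-1 *: \sum_(u : {ffun 'I_k -> 'I_m})
    \sum_(t : {ffun 'I_k -> 'I_D.+1}) (\prod_a ewt D (t a)) *:
      plug y (fun i => (\sum_(a | u a == i) (t a : nat)%:R) *: delta_mx 0 i).
Proof.
apply: eq_bigr => k _; congr (_ *: _); apply: eq_bigr => u _.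
rewrite /mproj {1}/plug linear_sum; apply: eq_bigr => t _.
rewrite linearZ -/(plug _ _) !plug_mxmap; congr (_ *: _); apply: eq_plug => i.
rewrite scaler_suml [RHS]big_mkcond; apply: eq_bigr => a _.
rewrite mxE (bigD1 a) //= big1 ?addr0 => [|b /negPf ba]; last first.
  by rewrite !mxE eq_sym ba mulr0n scale0r.
rewrite !mxE eqxx mulr1n; case: eqP => [->|_]; first by rewrite scale1r.
by rewrite scale0r.
Qed.

Lemma mproj_linear D k a (y z : F 'rV[rat]_k) :
  mproj D (a *: y + z) = a *: mproj D y + mproj D z.
Proof.
rewrite /mproj scaler_sumr -big_split; apply: eq_bigr => t _ /=.
by rewrite linearP scalerDr !scalerA mulrC.
Qed.

Lemma resolve_linear D m a (y z : F 'rV[rat]_m) :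
  resolve D (a *: y + z) = a *: resolve D y + resolve D z.
Proof.
rewrite /resolve scaler_sumr -big_split; apply: eq_bigr => k _ /=.
rewrite !scalerA [a * _]mulrC -scalerA -scalerDr; congr (_ *: _).
rewrite scaler_sumr -big_split; apply: eq_bigr => u _ /=.
by rewrite linearP mproj_linear {1}/plug linearP.
Qed.

Lemma subrep_mproj (S : subrep F) D k (y : F 'rV[rat]_k) : S _ y -> S _ (mproj D y).
Proof.
move=> Sy; apply: (subspace_sum (subspace_subrep S _)) => t _.
by apply: (subspaceZ (subspace_subrep S _)); exact: subrep_fmap.
Qed.

End Operators.

Section Naturality.
Variables (F G : vfunctor) (h : nat_trans F G).

Lemma nt_plug n (x : F 'rV[rat]_n) (V : lmodType rat) (v : 'I_n -> V) :
  h V (plug x v) = plug (h _ x) v.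
Proof. exact: nt_natural. Qed.

Lemma nt_mxmap m n (M : 'M[rat]_(m, n)) (y : F 'rV[rat]_m) :
  h _ (mxmap F M y) = mxmap G M (h _ y).
Proof. exact: nt_natural. Qed.

Lemma nt_mproj D k (y : F 'rV[rat]_k) : h _ (mproj D y) = mproj D (h _ y).
Proof.
by rewrite linear_sum; apply: eq_bigr => t _; rewrite linearZ;
  congr (_ *: _); exact: nt_natural.
Qed.

Lemma nt_resolve D m (y : F 'rV[rat]_m) : h _ (resolve D y) = resolve D (h _ y).
Proof.
rewrite linear_sum; apply: eq_bigr => k _; rewrite linearZ; congr (_ *: _).
rewrite linear_sum; apply: eq_bigr => u _; by rewrite nt_plug nt_mproj nt_mxmap.
Qed.

Lemma nt_multiweight1 k (y : F 'rV[rat]_k) : multiweight1 y -> multiweight1 (h _ y).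
Proof. by move=> hy t; rewrite -nt_mxmap hy linearZ. Qed.

Lemma multiweight1_inj k (y : F 'rV[rat]_k) : injective (h 'rV[rat]_k) ->
  multiweight1 (h _ y) -> multiweight1 y.
Proof. by move=> hI hy t; apply: hI; rewrite nt_mxmap hy linearZ. Qed.

End Naturality.

(** * Direct sums of tensor powers *)

Section TensorSum.
Variables (idx : Type) (d : idx -> nat) (G : vfunctor).
Variable tau : forall (i : idx) (V : lmodType rat), {ffun 'I_(d i) -> V} -> G V.
Hypothesis tauP : is_sum_of_tensor_powers tau.

Definition bounded D (V : lmodType rat) (z : G V) : Prop :=
  forall K : G V -> Prop, subspace K ->
  (forall i v, (d i <= D)%N -> K (@tau i V v)) -> K z.

(** The maps [tau] land in the subspace of bounded elements. The universal map into it, followed by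
    the inclusion, fixes every [tau i V v], hence is the identity by uniqueness. *)
Lemma exists_bounded (V : lmodType rat) (z : G V) : exists D, bounded D z.
Proof.
pose K (z : G V) := exists D, bounded D z.
have hK : subspace K.
  split=> [|a x y [D hx] [D' hy]]; first by exists 0%N => K' hK' _; exact: hK'.1.
  exists (maxn D D') => K' hK' h; apply: hK'.2.
    by apply: hx => // i v iD; apply: h; rewrite leq_max iD.
  by apply: hy => // i v iD; apply: h; rewrite leq_max iD orbT.
have Kt i v : @tau i V v \in subspace_pred hK.
  by apply/asboolP; exists (d i) => K' _; apply.
pose phi i v : subspace_type hK := SubspaceType (Kt i v).
have phiP i : multilinear (phi i).
  by move=> v j a x y; apply: val_inj; rewrite [RHS]linearP; exact: (tau_multilinear tauP).
have [k [kE _]] := tau_universal tauP phiP.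
have [k' [_ k'U]] := tau_universal tauP (fun i => tau_multilinear tauP (i := i) (V := V)).
have lin : linear (fun z => val (k z)) by move=> a x y; rewrite !linearP.
have E1 := k'U idfun (fun i v => erefl).
have E2 : to_linear lin =1 k'.
  by apply: k'U => i v; rewrite /= kE.
by have := subspace_typeP (k z); rewrite [val _]E2 -E1.
Qed.

Lemma bounded_fmap D (V W : lmodType rat) (f : {linear V -> W}) (z : G V) :
  bounded D z -> bounded D (fmap G f z).
Proof.
move=> hz K hK h; apply: (hz (fun z => K (fmap G f z))) => [|i v iD].
  by split=> [|a x y hx hy]; rewrite ?linear0 ?linearP; [exact: hK.1 | exact: hK.2].
by rewrite (tau_natural tauP); exact: h.
Qed.

Lemma finite_support (V : lmodType rat) (z : G V) : exists s : seq V,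
  forall f : {linear V -> V}, (forall v, v \in s -> f v = v) -> fmap G f z = z.
Proof.
have [D hz] := exists_bounded z.
pose K z := exists s : seq V,
  forall f : {linear V -> V}, (forall v, v \in s -> f v = v) -> fmap G f z = z.
apply: (hz K) => [|i v _].
  split=> [|a x y [s hs] [s' hs']]; first by exists [::] => f _; exact: linear0.
  exists (s ++ s') => f hf; rewrite linearP hs ?hs' // => v vs; apply: hf;
    by rewrite mem_cat vs ?orbT.
exists (codom v) => f hf; rewrite (tau_natural tauP); congr tau.
by apply/ffunP => j; rewrite ffunE hf // codom_f.
Qed.

Definition basis_word n m (w : {ffun 'I_n -> 'I_m}) : {ffun 'I_n -> 'rV[rat]_m} :=
  [ffun j => delta_mx 0 (w j)].

Lemma bounded_basis D m (z : G 'rV[rat]_m) (K : G 'rV[rat]_m -> Prop) :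
  bounded D z -> subspace K ->
  (forall i w, (d i <= D)%N -> K (@tau i _ (basis_word w))) -> K z.
Proof.
move=> hz hK h; apply: hz => // i v iD.
apply: (multilinear_span (tau_multilinear tauP (i := i) (V := 'rV[rat]_m)) hK) => w.
exact: h.
Qed.

Lemma plug_tau i m (w : {ffun 'I_(d i) -> 'I_m}) (s : 'I_m -> rat) :
  plug (@tau i _ (basis_word w)) (fun a => s a *: delta_mx 0 a) =
  (\prod_j s (w j)) *: @tau i _ (basis_word w).
Proof.
rewrite /plug (tau_natural tauP) -(multilinearZ (tau_multilinear tauP (i := i) (V := _))).
congr tau; apply/ffunP => j; rewrite !ffunE /= lincomb_delta.
by [].
Qed.

Lemma diag_tau i m (w : {ffun 'I_(d i) -> 'I_m}) (s : 'rV[rat]_m) :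
  mxmap G (diag_mx s) (@tau i _ (basis_word w)) =
  (\prod_j s 0 (w j)) *: @tau i _ (basis_word w).
Proof.
rewrite -plug_tau; apply: fmap_ext => u /=; apply/rowP => a.
rewrite mul_mx_diag mxE /lincomb summxE (bigD1 a) //= big1 ?addr0 => [|b /negPf ba].
  by rewrite !mxE !eqxx mulr1.
by rewrite !mxE eq_sym ba !mulr0.
Qed.

(** On a basis word [resolve D] is multiplication by the scalar that [resolution_identity]
    computes. *)
Lemma resolve_bounded D m (z : G 'rV[rat]_m) : bounded D z -> resolve D z = z.
Proof.
move=> hz; apply: (bounded_basis (K := fun z => resolve D z = z) hz).
  split=> [|a x y hx hy]; last by rewrite resolve_linear hx hy.
  by have := resolve_linear D 1 (0 : G 'rV[rat]_m) 0; rewrite !scale1r addr0 => /eqP;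
    rewrite -subr_eq0 opprD addNKr oppr_eq0 => /eqP.
move=> i w iD; rewrite resolveE -[RHS]scale1r -[in RHS](resolution_identity w iD) scaler_suml.
apply: eq_bigr => k _; rewrite -scalerA; congr (_ *: _).
rewrite scaler_suml; apply: eq_bigr => u _; rewrite scaler_suml; apply: eq_bigr => t _.
by rewrite plug_tau scalerA.
Qed.

Lemma mproj_multiweight1 D k (z : G 'rV[rat]_k) : bounded D z -> multiweight1 (mproj D z).
Proof.
move=> hz s; apply: (bounded_basis (K := fun z =>
  mxmap G (diag_mx s) (mproj D z) = (\prod_i s 0 i) *: mproj D z) hz).
  split=> [|a x y hx hy].
    have -> : mproj D (0 : G 'rV[rat]_k) = 0.
      by rewrite /mproj big1 // => t _; rewrite linear0 scaler0.
    by rewrite linear0 scaler0.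
  by rewrite mproj_linear linearP hx hy scalerDr !scalerA mulrC.
move=> i w iD.
have -> : mproj D (@tau i _ (basis_word w)) =
    ([forall a, fiber w a == 1%N])%:R *: @tau i _ (basis_word w).
  rewrite -(ewt_prod w iD) scaler_suml; apply: eq_bigr => t _.
  rewrite diag_tau scalerA; congr (_ * _ *: _).
  by apply: eq_bigr => j _; rewrite mxE.
rewrite linearZ /= diag_tau; case: forallP => [h|_]; last by rewrite !scale0r scaler0.
rewrite !scale1r (prod_fiber w (fun a => s 0 a)); congr (_ *: _).
by apply: eq_bigr => a _; rewrite (eqP (h a)).
Qed.

End TensorSum.

(** A lift of [y] to the subfunctor of the tensor sum has finite support, so [y] comes from some
    F(Q^m), where [resolve] rewrites it through elements of multiweight (1, ..., 1) lying in [S].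
    The identities are checked in the tensor sum, pulled back along the injective [inc] and pushed
    forward along [proj]. *)
Lemma polynomial_generation (F : vfunctor) (S : subrep F) (V : lmodType rat) (y : F V)
    (K : F V -> Prop) :
  polynomial_functor F -> S V y -> subspace K ->
  (forall n (x : F 'rV[rat]_n) v, multiweight1 x -> S _ x -> K (plug x v)) -> K y.
Proof.
move=> [idx [d [G [tau [Q [inc [proj [tauP incI projS]]]]]]]] Sy hK h.
have [k ky] := projS V y.
have [s hs] := finite_support tauP (inc V k).
have [m [g [f fg]]] := finite_projection s.
have fmapC (E : vfunctor) (U W X : lmodType rat) (a : {linear U -> W}) (b : {linear W -> X}) z :
    fmap E b (fmap E a z) = fmap E (b \o a) z by exact/esym/fmap_comp.
have fgk : fmap Q f (fmap Q g k) = k.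
  by apply: incI; rewrite !nt_natural fmapC hs.
have fgy : fmap F f (fmap F g y) = y by rewrite -ky -!nt_natural fgk.
pose k' := fmap Q g k; pose y' := fmap F g y.
have ky' : proj _ k' = y' by rewrite /k' nt_natural ky.
have Sy' : S _ y' by exact: subrep_fmap.
have [D hD] := exists_bounded tauP (inc _ k').
have rk : resolve D k' = k' by apply: incI; rewrite nt_resolve; exact: resolve_bounded hD.
rewrite -fgy -/y' -ky' -rk nt_resolve ky' /resolve linear_sum.
apply: (subspace_sum hK) => l _; rewrite linearZ; apply: (subspaceZ hK).
rewrite linear_sum; apply: (subspace_sum hK) => u _.
rewrite fmap_plug; apply: h; last exact/subrep_mproj/subrep_fmap.
rewrite -ky' -nt_mxmap -nt_mproj; apply: nt_multiweight1.
apply: (multiweight1_inj (h := inc)); first exact: incI.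
rewrite nt_mproj nt_mxmap; apply: (mproj_multiweight1 tauP).
exact: bounded_fmap.
Qed.

Local Open Scope classical_set_scope.

Theorem theorem1 (A : tca) (I J : subrep A) (hI : GL_ideal I) (hJ : GL_ideal J) :
  (forall V : lmodType rat, GL_rad I V `<=` GL_rad J V) <->
  radical (at_Qinf I) `<=` radical (at_Qinf J).
Proof.
split=> [|IJ V y /(GL_radP hI) [S [n [hS Sy]]]]; first exact: radical_sub_of_GL_rad_sub.
apply: (polynomial_generation (tca_polynomial A) Sy (subspace_GL_rad hJ V)) => d x v hx Sx.
have [|N hN] := @radical_products A J hJ d x hx.
  (* The coefficients of the n-th power are products of [n] elements of [S], hence lie in [I]. *)
  move=> eps; apply: IJ; exists n.
  have [t|s' hs' ->] := @super_power A _ Qinf_parity S [:: generic_tensor hx eps] n.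
    by rewrite inE => /eqP ->.
  by exists s'; split=> // t /hs' /hS.
apply/(GL_radP hJ); exists (generated x), N; split; first exact: nilpotent_generated.
by move=> K _; apply.
Qed.
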